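(* For $M\in M_2(\mathbb O)$ let $\phi_M\colon\mathfrak h_2(\mathbb O)\to\mathfrak h_2(\mathbb O)$ be the real-linear map $$\phi_M(X)=\frac12\Big((MX)M^\dagger+M(XM^\dagger)\Big).$$ The set of all those transformations $\phi_M$, $M\in M_2(\mathbb O)$, which are invertible and determinant preserving, i.e. $\det(\phi_M(X))=\det(X)$ for all $X\in\mathfrak h_2(\mathbb O)$, generates a free group with the operation given by composition. It is also a Lie group whose Lie algebra is precisely $\mathfrak{sl}(2,\mathbb O)$.
   Context: $\mathbb O$ is the real algebra of octonions with standard basis $e_0=1,e_1,\dots,e_7$, conjugation $x\mapsto\bar x$, real part $\mathrm{Re}$ and norm given by $\|x\|^2=x\bar x$. $M_2(\mathbb O)$ is the set of $2\times2$ octonionic matrices, $M^\dagger$ is the conjugate transpose of $M$, and $\mathfrak h_2(\mathbb O)=\{X\in M_2(\mathbb O): X^\dagger=X\}$, a $10$-dimensional real vector space. For $X=\begin{pmatrix}\alpha&x\\ \bar x&\beta\end{pmatrix}\in\mathfrak h_2(\mathbb O)$ ($\alpha,\beta\in\mathbb R$, $x\in\mathbb O$), $\det(X)=\alpha\beta-\|x\|^2$. The generated group is viewed as a subgroup of $GL(\mathfrak h_2(\mathbb O))\cong GL(10,\mathbb R)$ with the inherited differential structure. The Lie algebra $\mathfrak{sl}(2,\mathbb O)$: as a real vector space, $\mathfrak{sl}(2,\mathbb O)=M_2'(\mathbb O)\oplus C(\mathbb O')\oplus\mathfrak{Der}(\mathbb O)$, where $M_2'(\mathbb O)$ is the space of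 traceless matrices in $M_2(\mathbb O)$, $\mathbb O'=\{d\in\mathbb O:\mathrm{Re}(d)=0\}$, $C(\mathbb O')=\{C_d: d\in\mathbb O'\}$ with $C_d(x)=dx-xd$, and $\mathfrak{Der}(\mathbb O)\cong\mathfrak g_2$ is the space of derivations of $\mathbb O$. Its elements act linearly on $\mathfrak h_2(\mathbb O)$: $N\in M_2'(\mathbb O)$ acts by $X\mapsto NX+XN^\dagger$, while $C_d\in C(\mathbb O')$ and $\mathfrak g\in\mathfrak{Der}(\mathbb O)$ act by being applied to each entry of $X$. Identifying $\mathfrak h_2(\mathbb O)$ with $\mathbb R^{10}$ by $(x_0,\dots,x_9)\leftrightarrow\begin{pmatrix}x_0+x_9&x\\ \bar x&x_0-x_9\end{pmatrix}$, $x=x_1+x_2e_1+\cdots+x_8e_7$, this action gives a linear bijection $\varphi\colon\mathfrak{sl}(2,\mathbb O)\to\mathfrak{so}(9,1)=\{\omega\in M_{10}(\mathbb R):\eta\omega=-(\eta\omega)^T\}$, where $\eta=\mathrm{diag}(1,-1,\dots,-1)$. The Lie bracket of $\mathfrak{sl}(2,\mathbb O)$ is the one defined by $[\mathcal M,\mathcal N]=\varphi^{-1}\big(\varphi(\mathcal M)\varphi(\mathcal N)-\varphi(\mathcal N)\varphi(\mathcal M)\big)$.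
   Formalization: ''Free group'' is false literally (M = diag(e_1,e_1) gives a non-identity admissible φ_M with φ_M∘φ_M = id); it is replaced by: the generated group consists exactly of all finite compositions of admissible φ_M. *)

(* Defs.v *)
(* MathComp / MathComp-Analysis; the real numbers are an arbitrary
   [R : realType]. *)
From HB Require Import structures.
From mathcomp Require Import all_boot all_order all_algebra.
From mathcomp Require Import all_classical all_reals all_analysis.

Set Implicit Arguments.
Unset Strict Implicit.
Unset Printing Implicit Defensive.

Import Order.TTheory GRing.Theory Num.Theory.
Import numFieldNormedType.Exports.

Local Open Scope classical_set_scope.
Local Open Scope ring_scope.

(** * Octonions *)

(* The row vector x stands for x_0 e_0 + ... + x_7 e_7. The sup norm that the
   library puts on row vectors is not the octonionic norm, which enters only
   through [onormsq]. *)
Notation oct R := 'rV[R]_8.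

(* The seven lines (a, b, c) of the oriented Fano plane:
   e_a e_b = e_c, and cyclically; i.e. e_i e_(i+1) = e_(i+3), indices mod 7. *)
Definition fano_lines : seq (nat * nat * nat) :=
  [:: (1, 2, 4); (2, 3, 5); (3, 4, 6); (4, 5, 7); (5, 6, 1); (6, 7, 2);
      (7, 1, 3)]%N.

Definition on_fano (i j k : nat) : bool :=
  [|| (i, j, k) \in fano_lines, (j, k, i) \in fano_lines
    | (k, i, j) \in fano_lines].

(* the coefficient of e_k in e_i e_j *)
Definition ocoef (R : realType) (i j k : nat) : R :=
  if i == 0%N then (j == k)%:R
  else if j == 0%N then (i == k)%:R
  else if i == j then - (k == 0%N)%:R
  else (on_fano i j k)%:R - (on_fano j i k)%:R.

Definition omul (R : realType) (x y : oct R) : oct R :=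
  \row_(k < 8) \sum_(i < 8) \sum_(j < 8) ocoef R i j k * (x 0 i * y 0 j).

Definition oRe (R : realType) (x : oct R) : R := x 0 0.

Definition oreal (R : realType) (a : R) : oct R := a *: delta_mx 0 0.

Definition oconj (R : realType) (x : oct R) : oct R :=
  \row_(k < 8) (if k == 0 then x 0 k else - x 0 k).

(* x * conj x is a real multiple of e_0; this is that real number *)
Definition onormsq (R : realType) (x : oct R) : R := oRe (omul x (oconj x)).

(** * 2 x 2 octonionic matrices *)

(* The library only scales matrices by elements of their own coefficient ring,
   so the real vector space structure is declared on a named copy. *)
Definition M2O (R : realType) : Type := 'M[oct R]_2.

HB.instance Definition _ (R : realType) := GRing.Zmodule.on (M2O R).

Section M2O_lmodule.
Variable R : realType.

Definition M2O_scale (a : R) (A : M2O R) : M2O R :=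
  map_mx (fun x : oct R => a *: x) A.

Fact M2O_scalerA a b A : M2O_scale a (M2O_scale b A) = M2O_scale (a * b) A.
Proof. by apply/matrixP => i j; rewrite !mxE scalerA. Qed.

Fact M2O_scale1r : left_id 1 M2O_scale.
Proof. by move=> A; apply/matrixP => i j; rewrite !mxE scale1r. Qed.

Fact M2O_scalerDr : right_distributive M2O_scale +%R.
Proof. by move=> a A B; apply/matrixP => i j; rewrite !mxE scalerDr. Qed.

Fact M2O_scalerDl A : {morph M2O_scale^~ A : a b / a + b}.
Proof. by move=> a b; apply/matrixP => i j; rewrite !mxE scalerDl. Qed.

HB.instance Definition _ := GRing.Zmodule_isLmodule.Build R (M2O R)
  M2O_scalerA M2O_scale1r M2O_scalerDr M2O_scalerDl.

End M2O_lmodule.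

Definition omulmx (R : realType) (A B : M2O R) : M2O R :=
  \matrix_(i, j) \sum_(k < 2) omul (A i k) (B k j).

Definition odag (R : realType) (A : M2O R) : M2O R :=
  \matrix_(i, j) oconj (A j i).

Definition h2 (R : realType) : set (M2O R) := [set X | odag X = X].

(* alpha beta - |x|^2; meaningful on [h2] only *)
Definition h2det (R : realType) (X : M2O R) : R :=
  oRe (X 0 0) * oRe (X 1 1) - onormsq (X 0 1).

(** * Coordinates: h_2(O) = R^10 and End(h_2(O)) = M_10(R) *)

Definition h2_of_cV (R : realType) (v : 'cV[R]_10) : M2O R :=
  let x : oct R := \row_(k < 8) v (inord k.+1) 0 in
  \matrix_(i, j)
    if i == 0 then
      if j == 0 then oreal (v ord0 0 + v ord_max 0) else x
    else
      if j == 0 then oconj x else oreal (v ord0 0 - v ord_max 0).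

(* the inverse of [h2_of_cV] on [h2] *)
Definition cV_of_h2 (R : realType) (X : M2O R) : 'cV[R]_10 :=
  \col_(i < 10)
    if i == ord0 then (oRe (X 0 0) + oRe (X 1 1)) / 2
    else if i == ord_max then (oRe (X 0 0) - oRe (X 1 1)) / 2
    else X 0 1 0 (inord i.-1).

(* the matrix, acting on column vectors, of a linear map h_2(O) -> h_2(O) *)
Definition h2_matrix (R : realType) (F : M2O R -> M2O R) : 'M[R]_10 :=
  \matrix_(i, j) cV_of_h2 (F (h2_of_cV (delta_mx j 0))) i 0.

(** * The transformations phi_M and the group they generate *)

Definition phi (R : realType) (M X : M2O R) : M2O R :=
  2^-1 *: (omulmx (omulmx M X) (odag M) + omulmx M (omulmx X (odag M))).

Definition admissible (R : realType) (M : M2O R) : Prop :=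
  set_bij (@h2 R) (@h2 R) (phi M) /\
  forall X : M2O R, h2 X -> h2det (phi M X) = h2det X.

Definition is_GL_subgroup (R : realType) (n : nat) (G : set 'M[R]_n) : Prop :=
  [/\ forall g, G g -> g \in unitmx,
      G 1%:M,
      forall g h, G g -> G h -> G (g *m h)
    & forall g, G g -> G (invmx g)].

Definition SL2O (R : realType) : set 'M[R]_10 :=
  smallest (@is_GL_subgroup R 10)
    [set h2_matrix (phi M) | M in @admissible R].

(** * Smooth maps, embedded submanifolds, Lie subgroups of GL_n(R) *)

(* C^k on the open set U, for finite-dimensional V and W *)
Fixpoint Ck_on (R : realType) (V W : normedModType R) (k : nat) (U : set V)
    (f : V -> W) : Prop :=
  if k is k'.+1 then
    (forall x, U x -> differentiable f x) /\
    (forall v, Ck_on k' U (fun x => 'D_v f x))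
  else forall x, U x -> {for x, continuous f}.

Definition smooth_on (R : realType) (V W : normedModType R) (U : set V)
    (f : V -> W) : Prop := forall k, Ck_on k U f.

(* f is smooth for the structure that S inherits from V: near each point of S
   it is the restriction of a smooth map defined on an open subset of V *)
Definition smooth_along (R : realType) (V W : normedModType R) (S : set V)
    (f : V -> W) : Prop :=
  forall p, S p -> exists (U : set V) (F : V -> W),
    [/\ open U, U p, smooth_on U F & forall x, U x -> S x -> F x = f x].

(* existence of slice charts: f : U -> U' is a diffeomorphism of open subsets
   of M_n(R), with inverse f', which carries S `&` U to E `&` U', where E is a
   d-dimensional linear subspace *)
Definition embedded_submanifold (R : realType) (n : nat) (S : set 'M[R]_n) :
    Prop :=
  exists d : nat, forall p, S p ->
    exists (U U' : set 'M[R]_n) (f f' : 'M[R]_n -> 'M[R]_n)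
           (E : {vspace 'M[R]_n}),
      [/\ [/\ open U, open U', U p & \dim E = d],
          smooth_on U f /\ smooth_on U' f',
          (forall x, U x -> U' (f x) /\ f' (f x) = x),
          (forall y, U' y -> U (f' y) /\ f (f' y) = y)
        & forall x, U x -> (S x <-> f x \in E)].

(* a subgroup of GL_n(R) which is a Lie group for the inherited structure *)
Definition is_Lie_subgroup (R : realType) (n : nat) (G : set 'M[R]_n) : Prop :=
  [/\ is_GL_subgroup G,
      embedded_submanifold G,
      smooth_along (G `*` G) (fun gh : 'M[R]_n * 'M[R]_n => gh.1 *m gh.2)
    & smooth_along G (fun g : 'M[R]_n => invmx g)].

(* the tangent space at the identity: velocities of smooth curves in G *)
Definition Lie_algebra (R : realType) (n : nat) (G : set 'M[R]_n) :
    set 'M[R]_n :=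
  [set A | exists (e : R) (c : R -> 'M[R]_n),
     [/\ 0 < e, smooth_on [set` `]- e, e[ ] c,
         (forall t, t \in `]- e, e[ -> G (c t)),
         c 0 = 1%:M & is_derive (0 : R) (1 : R) c A]].

(* the bracket of the Lie algebra of a subgroup of GL_n(R) *)
Definition mx_bracket (R : realType) (n : nat) (A B : 'M[R]_n) : 'M[R]_n :=
  A *m B - B *m A.

(** * The Lie algebra sl(2, O) *)

Definition traceless (R : realType) : set (M2O R) :=
  [set N | N 0 0 + N 1 1 = 0].

Definition C_ImO (R : realType) : set 'End(oct R) :=
  [set C : 'End(oct R) | exists2 d : oct R, oRe d = 0 &
     forall x : oct R, C x = omul d x - omul x d].

Definition Der_O (R : realType) : set 'End(oct R) :=
  [set D : 'End(oct R) |
     forall x y : oct R, D (omul x y) = omul (D x) y + omul x (D y)].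

(* the ambient real vector space of the external direct sum *)
Definition sl2O_space (R : realType) : Type :=
  (M2O R * 'End(oct R) * 'End(oct R))%type.

HB.instance Definition _ (R : realType) := GRing.Lmodule.on (sl2O_space R).

Definition sl2O (R : realType) : set (sl2O_space R) :=
  [set u | [/\ traceless u.1.1, C_ImO u.1.2 & Der_O u.2]].

Definition sl2O_act (R : realType) (u : sl2O_space R) (X : M2O R) : M2O R :=
  (omulmx u.1.1 X + omulmx X (odag u.1.1) : M2O R)
  + map_mx u.1.2 X + map_mx u.2 X.

(* the map called varphi : sl(2, O) -> so(9, 1) *)
Definition sl2O_matrix (R : realType) (u : sl2O_space R) : 'M[R]_10 :=
  h2_matrix (sl2O_act u).

(* varphi^-1 (varphi u varphi v - varphi v varphi u); the default value 0 is
   never used, as varphi is a bijection from sl(2, O) to so(9, 1) *)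
Definition sl2O_bracket (R : realType) (u v : sl2O_space R) : sl2O_space R :=
  xget 0 [set w | sl2O w /\
                  sl2O_matrix w = mx_bracket (sl2O_matrix u) (sl2O_matrix v)].

(* Main.v *)
(* For a Hermitian M with coordinate vector m, the Jordan identities turn phi_M
   into the matrix 2 m m^T - q(m) eta, where eta is the Minkowski matrix and q its
   quadratic form; when q(m) = 1 or -1 this is q(m) s_m s_0, with s_m the
   reflection in m and s_0 the one in the time axis. So the compositions of
   admissible maps contain s_u s_w whenever q(u) q(w) > 0 and, by the
   Cartan-Dieudonne argument, every Lorentz matrix g with g_00 > 0 and det g > 0.
   Squares of Lorentz matrices are of this kind, which makes the compositions
   closed under inversion. The generated group is thus an open subgroup of O(9,1);
   the Cayley transform provides its slice charts, and its Lie algebra is so(9,1).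

   That sl(2, O) is so(9,1) reduces to the decomposition of so(8) acting on O as
   {L_a + R_a} + {L_d - R_d} + Der(O), with a, d imaginary: the value at 1 gives a,
   the contraction with the structure constants gives d, and a skew matrix killing
   1 with zero contraction is a derivation. *)
Require Import Defs.
From HB Require Import structures.
From mathcomp Require Import all_boot all_order all_algebra.
From mathcomp Require Import all_classical all_reals all_analysis.
From mathcomp Require Import ring lra zify.

Set Implicit Arguments.
Unset Strict Implicit.
Unset Printing Implicit Defensive.

Import Order.TTheory GRing.Theory Num.Theory.
Import numFieldNormedType.Exports.

Local Open Scope classical_set_scope.
Local Open Scope ring_scope.

(** * Octonions in coordinates *)

(** Since the octonions are not associative, phi_M followed by phi_N is in general no phi of a
    product, and of an admissible M that is not Hermitian the proof uses only that phi_M preserves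
    the Minkowski form. Hence the inverse of such a generator is not visibly a composition of
    generators, which is why inversion goes through squares: if g is a composition, then g^-1 = g
    (g^-1)^2, and the second factor is caught by the two inequalities whatever component g lies in.
    For the same reason it is left open which components of O(9,1) are met. Only the component cut
    out by g_00 > 0 and det g > 0 is shown to be contained in the group, and since both inequalities
    are open conditions, charts and curves can be confined to it. *)

Section OctonionCoordinates.
Variable R : realType.
Implicit Types (a : R).

Definition mkoct (x0 x1 x2 x3 x4 x5 x6 x7 : R) : oct R :=
  \row_k [:: x0; x1; x2; x3; x4; x5; x6; x7]`_k.

(** The ordinals carry the closed proof [isT], so that the entries of an explicit row reduce by
    computation. *)
Lemma forall_ord8 (P : 'I_8 -> Prop) :
  P (@Ordinal 8 0 isT) -> P (@Ordinal 8 1 isT) -> P (@Ordinal 8 2 isT) ->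
    P (@Ordinal 8 3 isT) ->
  P (@Ordinal 8 4 isT) -> P (@Ordinal 8 5 isT) -> P (@Ordinal 8 6 isT) ->
    P (@Ordinal 8 7 isT) ->
  forall k, P k.
Proof.
move=> P0 P1 P2 P3 P4 P5 P6 P7 [k k8].
by do 8?[case: k k8 => [|k] k8; first by rewrite (bool_irrelevance k8 isT)].
Qed.

Local Ltac by_coord :=
  by apply/rowP; apply: forall_ord8; rewrite !mxE /= ?mulr1 ?mulr0.

(** Destructing [octP x] replaces an octonion by eight real variables; after rewriting with [octE],
    an octonion identity becomes eight polynomial identities for [ring]. *)
Variant oct_spec : oct R -> Type :=
  OctSpec (x0 x1 x2 x3 x4 x5 x6 x7 : R) :
    oct_spec (mkoct x0 x1 x2 x3 x4 x5 x6 x7).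

Lemma octP (x : oct R) : oct_spec x.
Proof.
have -> : x = mkoct (x 0 (inord 0)) (x 0 (inord 1)) (x 0 (inord 2))
  (x 0 (inord 3)) (x 0 (inord 4)) (x 0 (inord 5)) (x 0 (inord 6))
    (x 0 (inord 7)).
  apply/rowP => k; rewrite mxE -{1}(inord_val k).
  by case: k => k kP /=; do 8?[case: k kP => [|k] kP //].
by constructor.
Qed.

Lemma mkoct_eq x0 x1 x2 x3 x4 x5 x6 x7 y0 y1 y2 y3 y4 y5 y6 y7 :
  [/\ x0 = y0, x1 = y1, x2 = y2 & x3 = y3] ->
  [/\ x4 = y4, x5 = y5, x6 = y6 & x7 = y7] ->
  mkoct x0 x1 x2 x3 x4 x5 x6 x7 = mkoct y0 y1 y2 y3 y4 y5 y6 y7.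
Proof. by move=> [-> -> -> ->] [-> -> -> ->]. Qed.

Lemma oRe_mk x0 x1 x2 x3 x4 x5 x6 x7 : oRe (mkoct x0 x1 x2 x3 x4 x5 x6 x7) = x0.
Proof. by rewrite /oRe mxE. Qed.

Lemma oD_mk x0 x1 x2 x3 x4 x5 x6 x7 y0 y1 y2 y3 y4 y5 y6 y7 :
  mkoct x0 x1 x2 x3 x4 x5 x6 x7 + mkoct y0 y1 y2 y3 y4 y5 y6 y7 =
    mkoct (x0 + y0) (x1 + y1) (x2 + y2) (x3 + y3) (x4 + y4) (x5 + y5) (x6 +
      y6) (x7 + y7).
Proof. by_coord. Qed.

Lemma oN_mk x0 x1 x2 x3 x4 x5 x6 x7 :
  - mkoct x0 x1 x2 x3 x4 x5 x6 x7 =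
    mkoct (- x0) (- x1) (- x2) (- x3) (- x4) (- x5) (- x6) (- x7).
Proof. by_coord. Qed.

Lemma oZ_mk a x0 x1 x2 x3 x4 x5 x6 x7 :
  a *: mkoct x0 x1 x2 x3 x4 x5 x6 x7 =
    mkoct (a * x0) (a * x1) (a * x2) (a * x3) (a * x4) (a * x5) (a * x6) (a *
      x7).
Proof. by_coord. Qed.

Lemma oconj_mk x0 x1 x2 x3 x4 x5 x6 x7 :
  oconj (mkoct x0 x1 x2 x3 x4 x5 x6 x7) =
    mkoct x0 (- x1) (- x2) (- x3) (- x4) (- x5) (- x6) (- x7).
Proof. by_coord. Qed.

Lemma oreal_mk a : oreal a = mkoct a 0 0 0 0 0 0 0.
Proof. by_coord. Qed.

Lemma o0_mk : 0 = mkoct 0 0 0 0 0 0 0 0.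
Proof. by_coord. Qed.

Lemma omul_mk x0 x1 x2 x3 x4 x5 x6 x7 y0 y1 y2 y3 y4 y5 y6 y7 :
  omul (mkoct x0 x1 x2 x3 x4 x5 x6 x7) (mkoct y0 y1 y2 y3 y4 y5 y6 y7) = mkoct
    (x0 * y0 - x1 * y1 - x2 * y2 - x3 * y3 - x4 * y4 - x5 * y5 - x6 * y6 - x7 *
      y7)
    (x0 * y1 + x1 * y0 + x2 * y4 - x4 * y2 + x5 * y6 - x6 * y5 + x3 * y7 - x7 *
      y3)
    (x0 * y2 + x2 * y0 + x4 * y1 - x1 * y4 + x3 * y5 - x5 * y3 + x6 * y7 - x7 *
      y6)
    (x0 * y3 + x3 * y0 + x5 * y2 - x2 * y5 + x4 * y6 - x6 * y4 + x7 * y1 - x1 *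
      y7)
    (x0 * y4 + x4 * y0 + x1 * y2 - x2 * y1 + x6 * y3 - x3 * y6 + x5 * y7 - x7 *
      y5)
    (x0 * y5 + x5 * y0 + x2 * y3 - x3 * y2 + x7 * y4 - x4 * y7 + x6 * y1 - x1 *
      y6)
    (x0 * y6 + x6 * y0 + x3 * y4 - x4 * y3 + x1 * y5 - x5 * y1 + x7 * y2 - x2 *
      y7)
    (x0 * y7 + x7 * y0 + x4 * y5 - x5 * y4 + x2 * y6 - x6 * y2 + x1 * y3 - x3 *
      y1).
Proof.
have omulE (k : 'I_8) : omul (mkoct x0 x1 x2 x3 x4 x5 x6 x7)
  (mkoct y0 y1 y2 y3 y4 y5 y6 y7) 0 k =
    \sum_(0 <= i < 8) \sum_(0 <= j < 8) ocoef R i j k *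
      ([:: x0; x1; x2; x3; x4; x5; x6; x7]`_i *
        [:: y0; y1; y2; y3; y4; y5; y6; y7]`_j).
  rewrite mxE big_mkord; apply: eq_bigr => i _.
  by rewrite big_mkord; apply: eq_bigr => j _; rewrite !mxE.
apply/rowP => k; rewrite omulE mxE unlock; case: k => k kP /=.
do 8?[case: k kP => [|k] kP /=; first by rewrite /ocoef /= /on_fano /=; ring].
by [].
Qed.

Definition octE := (oRe_mk, oD_mk, oN_mk, oZ_mk, oconj_mk, oreal_mk, o0_mk,
  omul_mk).

Definition odot (x y : oct R) : R := oRe (omul x (oconj y)).

(** For imaginary d this says that left multiplication by d is skew, and [odot_mulr] does the same
    on the right; the so(8) part of the action gets its skewness from these two. *)
Lemma odot_mull (d x : oct R) : odot x (omul d x) = oRe d * onormsq x.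
Proof.
rewrite /odot /onormsq; case: (octP x) => *; case: (octP d) => *;
  rewrite !octE; ring.
Qed.

Lemma odot_mulr (d x : oct R) : odot x (omul x d) = oRe d * onormsq x.
Proof.
rewrite /odot /onormsq; case: (octP x) => *; case: (octP d) => *;
  rewrite !octE; ring.
Qed.

Definition ent (A : 'M[R]_8) i j : R := A (inord i) (inord j).

(* Contraction of [A] with the structure constants e_i e_j = e_k; it takes the
   value [6 *: d] on the matrix of x |-> d x - x d. *)
Definition rot_axis (A : 'M[R]_8) : oct R :=
  mkoct 0 (ent A 2 4 + ent A 5 6 + ent A 3 7)
   (ent A 4 1 + ent A 3 5 + ent A 6 7)
   (ent A 5 2 + ent A 4 6 + ent A 7 1)
   (ent A 1 2 + ent A 6 3 + ent A 5 7)
   (ent A 2 3 + ent A 7 4 + ent A 6 1)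
   (ent A 3 4 + ent A 1 5 + ent A 7 2)
   (ent A 4 5 + ent A 2 6 + ent A 1 3).

(* Derivations are exactly the elements of so(7) with zero contraction; only
   the implication in [g2_matrix_der] is needed. *)
Definition g2_matrix (A : 'M[R]_8) :=
  [/\ A^T = - A, forall i, ent A 0 i = 0 & rot_axis A = 0].

Lemma omulmx_mk A x0 x1 x2 x3 x4 x5 x6 x7 :
  mkoct x0 x1 x2 x3 x4 x5 x6 x7 *m A = mkoct
    (x0 * ent A 0 0 + x1 * ent A 1 0 + x2 * ent A 2 0 + x3 * ent A 3 0
     + x4 * ent A 4 0 + x5 * ent A 5 0 + x6 * ent A 6 0 + x7 * ent A 7 0)
    (x0 * ent A 0 1 + x1 * ent A 1 1 + x2 * ent A 2 1 + x3 * ent A 3 1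
     + x4 * ent A 4 1 + x5 * ent A 5 1 + x6 * ent A 6 1 + x7 * ent A 7 1)
    (x0 * ent A 0 2 + x1 * ent A 1 2 + x2 * ent A 2 2 + x3 * ent A 3 2
     + x4 * ent A 4 2 + x5 * ent A 5 2 + x6 * ent A 6 2 + x7 * ent A 7 2)
    (x0 * ent A 0 3 + x1 * ent A 1 3 + x2 * ent A 2 3 + x3 * ent A 3 3
     + x4 * ent A 4 3 + x5 * ent A 5 3 + x6 * ent A 6 3 + x7 * ent A 7 3)
    (x0 * ent A 0 4 + x1 * ent A 1 4 + x2 * ent A 2 4 + x3 * ent A 3 4
     + x4 * ent A 4 4 + x5 * ent A 5 4 + x6 * ent A 6 4 + x7 * ent A 7 4)
    (x0 * ent A 0 5 + x1 * ent A 1 5 + x2 * ent A 2 5 + x3 * ent A 3 5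
     + x4 * ent A 4 5 + x5 * ent A 5 5 + x6 * ent A 6 5 + x7 * ent A 7 5)
    (x0 * ent A 0 6 + x1 * ent A 1 6 + x2 * ent A 2 6 + x3 * ent A 3 6
     + x4 * ent A 4 6 + x5 * ent A 5 6 + x6 * ent A 6 6 + x7 * ent A 7 6)
    (x0 * ent A 0 7 + x1 * ent A 1 7 + x2 * ent A 2 7 + x3 * ent A 3 7
     + x4 * ent A 4 7 + x5 * ent A 5 7 + x6 * ent A 6 7 + x7 * ent A 7 7).
Proof.
have E (k : 'I_8) : (mkoct x0 x1 x2 x3 x4 x5 x6 x7 *m A) 0 k =
    \sum_(0 <= i < 8) [:: x0; x1; x2; x3; x4; x5; x6; x7]`_i * ent A i k.
  by rewrite mxE big_mkord; apply: eq_bigr => i _; rewrite mxE /ent !inord_val.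
apply/rowP => k; rewrite E mxE unlock; case: k => k kP /=.
by do 8?[case: k kP => [|k] kP /=; first by rewrite addr0 !addrA].
Qed.

Lemma mkoct_inj x0 x1 x2 x3 x4 x5 x6 x7 y0 y1 y2 y3 y4 y5 y6 y7 :
  mkoct x0 x1 x2 x3 x4 x5 x6 x7 = mkoct y0 y1 y2 y3 y4 y5 y6 y7 ->
  [/\ x0 = y0, x1 = y1, x2 = y2 & x3 = y3] /\
    [/\ x4 = y4, x5 = y5, x6 = y6 & x7 = y7].
Proof.
move/rowP => E.
have {}E i (i8 : (i < 8)%N) := E (Ordinal i8).
have := (E 0%N isT, E 1%N isT, E 2%N isT, E 3%N isT,
  E 4%N isT, E 5%N isT, E 6%N isT, E 7%N isT).
by rewrite !mxE /= => -[[[[[[[-> ->] ->] ->] ->] ->] ->] ->].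
Qed.

End OctonionCoordinates.

Ltac oct_ring := rewrite !octE; apply: mkoct_eq; split; ring.

(** * Skew matrices with zero contraction are derivations *)

Section G2Matrix.
Variable R : realType.

(** A skew matrix killing 1 has 21 free entries, and each of the seven contraction equations
    eliminates one. In the remaining 14, the dimension of g_2, the Leibniz rule is a polynomial
    identity. *)
Lemma g2_matrix_der (A : 'M[R]_8) (x y : oct R) : g2_matrix A ->
  omul x y *m A = omul (x *m A) y + omul x (y *m A).
Proof.
move=> [AT A0 A1].
have AN i j : ent A j i = - ent A i j.
  by move/matrixP: AT => /(_ (inord i) (inord j)); rewrite !mxE.
have Ad i : ent A i i = 0 by have := AN i i; lra.
move: A1; rewrite /rot_axis o0_mk => /mkoct_inj[[_ A1 A2 A3] [A4 A5 A6 A7]].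
have B24 : ent A 2 4 = - ent A 5 6 - ent A 3 7 by lra.
have B41 : ent A 4 1 = - ent A 3 5 - ent A 6 7 by lra.
have B52 : ent A 5 2 = - ent A 4 6 - ent A 7 1 by lra.
have B12 : ent A 1 2 = - ent A 6 3 - ent A 5 7 by lra.
have B23 : ent A 2 3 = - ent A 7 4 - ent A 6 1 by lra.
have B34 : ent A 3 4 = - ent A 1 5 - ent A 7 2 by lra.
have B45 : ent A 4 5 = - ent A 2 6 - ent A 1 3 by lra.
case: (octP x) => *; case: (octP y) => *.
rewrite !(omul_mk, omulmx_mk, oD_mk) ?A0 ?(AN 0) ?A0 ?Ad.
rewrite ?(AN 5 6) ?(AN 3 7) ?(AN 3 5) ?(AN 6 7) ?(AN 4 6) ?(AN 1 7) ?(AN 3 6)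
  ?(AN 5 7) ?(AN 4 7) ?(AN 1 6) ?(AN 1 5) ?(AN 2 7) ?(AN 2 6) ?(AN 1 3)
    ?(AN 2 4) ?(AN 4 1) ?(AN 5 2) ?(AN 1 2) ?(AN 2 3) ?(AN 3 4) ?(AN 4 5) ?B24
      ?B41 ?B52 ?B12 ?B23 ?B34 ?B45 ?(AN 5 6) ?(AN 3 7) ?(AN 3 5) ?(AN 6 7)
        ?(AN 4 6) ?(AN 1 7) ?(AN 3 6) ?(AN 5 7) ?(AN 4 7) ?(AN 1 6) ?(AN 1 5)
          ?(AN 2 7) ?(AN 2 6) ?(AN 1 3).
clear.
move: (ent A 5 6) (ent A 3 7) (ent A 3 5) (ent A 6 7) (ent A 4 6) (ent A 1 7)
  (ent A 3 6) (ent A 5 7) (ent A 4 7) (ent A 1 6) (ent A 1 5) (ent A 2 7)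
    (ent A 2 6) (ent A 1 3) => *.
apply: mkoct_eq; split; ring.
Qed.
End G2Matrix.

(** * Octonion identities, commutators and the splitting of so(7) *)

Section OctonionAlgebra.
Variable R : realType.
Implicit Types (a : R).

Lemma omulDl (x y z : oct R) : omul (x + y) z = omul x z + omul y z.
Proof.
by case: (octP x) => *; case: (octP y) => *; case: (octP z) => *; oct_ring.
Qed.

Lemma omulDr (x y z : oct R) : omul x (y + z) = omul x y + omul x z.
Proof.
by case: (octP x) => *; case: (octP y) => *; case: (octP z) => *; oct_ring.
Qed.

Lemma omulZl a (x y : oct R) : omul (a *: x) y = a *: omul x y.
Proof.
by case: (octP x) => *; case: (octP y) => *; oct_ring.
Qed.

Lemma omulZr a (x y : oct R) : omul x (a *: y) = a *: omul x y.
Proof.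
by case: (octP x) => *; case: (octP y) => *; oct_ring.
Qed.

Lemma oconj_linear : linear (@oconj R).
Proof.
by move=> a x y; case: (octP x) => *; case: (octP y) => *; oct_ring.
Qed.

Lemma oconjK : involutive (@oconj R).
Proof. by move=> x; case: (octP x) => *; oct_ring. Qed.

Lemma oconjM (x y : oct R) : oconj (omul x y) = omul (oconj y) (oconj x).
Proof.
by case: (octP x) => *; case: (octP y) => *; oct_ring.
Qed.

(** By alternativity the Leibniz defect of the commutator with d is -3 times the associator
    [d, x, y], and only real octonions associate with everything. This makes the sum of C(O') and
    Der(O) direct. *)
Lemma commutator_der_eq0 (d : oct R) : oRe d = 0 ->
  (forall x y, let C z := omul d z - omul z d in
    C (omul x y) = omul (C x) y + omul x (C y)) -> d = 0.
Proof.
case: (octP d) => d0 d1 d2 d3 d4 d5 d6 d7; rewrite oRe_mk => -> CD.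
pose im := mkoct 0 d1 d2 d3 d4 d5 d6 d7.
pose C z := omul im z - omul z im.
pose e1 : oct R := mkoct 0 1 0 0 0 0 0 0.
pose e2 : oct R := mkoct 0 0 1 0 0 0 0 0.
pose e3 : oct R := mkoct 0 0 0 1 0 0 0 0.
pose e4 : oct R := mkoct 0 0 0 0 1 0 0 0.
pose e5 : oct R := mkoct 0 0 0 0 0 1 0 0.
pose e7 : oct R := mkoct 0 0 0 0 0 0 0 1.
have C1 : C e1 = 2 *: mkoct 0 0 d4 d7 (- d2) d6 (- d5) (- d3).
  by rewrite /C /im /e1 !octE; apply: mkoct_eq; split; ring.
have C2 : C e2 = 2 *: mkoct 0 (- d4) 0 d5 d1 (- d3) d7 (- d6).
  by rewrite /C /im /e2 !octE; apply: mkoct_eq; split; ring.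
have C3 : C e3 = 2 *: mkoct 0 (- d7) (- d5) 0 d6 d2 (- d4) d1.
  by rewrite /C /im /e3 !octE; apply: mkoct_eq; split; ring.
have C4 : C e4 = 2 *: mkoct 0 d2 (- d1) (- d6) 0 d7 d3 (- d5).
  by rewrite /C /im /e4 !octE; apply: mkoct_eq; split; ring.
have C5 : C e5 = 2 *: mkoct 0 (- d6) d3 (- d2) (- d7) 0 d1 d4.
  by rewrite /C /im /e5 !octE; apply: mkoct_eq; split; ring.
have C7 : C e7 = 2 *: mkoct 0 d3 d6 (- d1) d5 (- d4) (- d2) 0.
  by rewrite /C /im /e7 !octE; apply: mkoct_eq; split; ring.
have M12 : omul e1 e2 = e4.
  by rewrite /e1 /e2 /e4 !octE; apply: mkoct_eq; split; ring.
have M35 : omul e3 e5 = e2.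
  by rewrite /e3 /e5 /e2 !octE; apply: mkoct_eq; split; ring.
have M45 : omul e4 e5 = e7.
  by rewrite /e4 /e5 /e7 !octE; apply: mkoct_eq; split; ring.
(* [d, e_a, e_b] only sees the coordinates of d off the line through e_a and
   e_b, and no coordinate is on all of the three lines used here. *)
have CE x y : C (omul x y) = omul (C x) y + omul x (C y) := CD x y.
have := (CE e1 e2, CE e3 e5, CE e4 e5).
rewrite M12 M35 M45 C1 C2 C3 C4 C5 C7 !(oZ_mk, omul_mk, oD_mk) => -[[]].
move=> /mkoct_inj[[_ _ _ h3] [_ h5 h6 h7]].
move=> /mkoct_inj[[_ h1 _ _] [h4 _ _ _]].
move=> /mkoct_inj[[_ _ _ _] [_ _ h2 _]].
have d60 : d6 = 0 by clear -h3; lra.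
have d30 : d3 = 0 by clear -h6; lra.
have d50 : d5 = 0 by clear -h7; lra.
have d70 : d7 = 0 by clear -h5; lra.
have d40 : d4 = 0 by clear -h1; lra.
have d10 : d1 = 0 by clear -h4; lra.
have d20 : d2 = 0 by clear -h2; lra.
by rewrite d10 d20 d30 d40 d50 d60 d70 o0_mk.
Qed.

(** Half the commutator with the imaginary octonion d, acting on rows from the right; with the half,
    every entry is 0 or a coordinate of d up to sign. *)
Definition ad_mx (d : seq R) : 'M[R]_8 := \matrix_(i, j)
  (nth [::] [:: [:: 0; 0; 0; 0; 0; 0; 0; 0];
    [:: 0; 0; d`_4; d`_7; - d`_2; d`_6; - d`_5; - d`_3];
    [:: 0; - d`_4; 0; d`_5; d`_1; - d`_3; d`_7; - d`_6];
    [:: 0; - d`_7; - d`_5; 0; d`_6; d`_2; - d`_4; d`_1];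
    [:: 0; d`_2; - d`_1; - d`_6; 0; d`_7; d`_3; - d`_5];
    [:: 0; - d`_6; d`_3; - d`_2; - d`_7; 0; d`_1; d`_4];
    [:: 0; d`_5; - d`_7; d`_4; - d`_3; - d`_1; 0; d`_2];
    [:: 0; d`_3; d`_6; - d`_1; d`_5; - d`_4; - d`_2; 0]] i)`_j.

Lemma ent_ad_mx d i j : (i < 8)%N -> (j < 8)%N -> ent (ad_mx d) i j =
  (nth [::] [:: [:: 0; 0; 0; 0; 0; 0; 0; 0];
    [:: 0; 0; d`_4; d`_7; - d`_2; d`_6; - d`_5; - d`_3];
    [:: 0; - d`_4; 0; d`_5; d`_1; - d`_3; d`_7; - d`_6];
    [:: 0; - d`_7; - d`_5; 0; d`_6; d`_2; - d`_4; d`_1];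
    [:: 0; d`_2; - d`_1; - d`_6; 0; d`_7; d`_3; - d`_5];
    [:: 0; - d`_6; d`_3; - d`_2; - d`_7; 0; d`_1; d`_4];
    [:: 0; d`_5; - d`_7; d`_4; - d`_3; - d`_1; 0; d`_2];
    [:: 0; d`_3; d`_6; - d`_1; d`_5; - d`_4; - d`_2; 0]] i)`_j.
Proof. by move=> i8 j8; rewrite /ent mxE !inordK. Qed.

Lemma ad_mx_skew d : (ad_mx d)^T = - ad_mx d.
Proof.
apply/matrixP => i j; rewrite !mxE.
case: i => i iP; case: j => j jP /=.
by do 8?[case: i iP => [|i] iP; [do 8?[case: j jP => [|j] jP;
  [by rewrite /= ?opprK ?oppr0|]]; by []|]].
Qed.

Lemma mul_ad_mx d x : x *m ad_mx d =
  2^-1 *: (omul (mkoct 0 d`_1 d`_2 d`_3 d`_4 d`_5 d`_6 d`_7) x -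
    omul x (mkoct 0 d`_1 d`_2 d`_3 d`_4 d`_5 d`_6 d`_7)).
Proof.
case: (octP x) => *; rewrite !omulmx_mk !ent_ad_mx // !octE /=.
by apply: mkoct_eq; split; field.
Qed.

(** The contraction of [ad_mx s] is three times the imaginary octonion with coordinates s, so
    choosing for s a third of the contraction of A leaves a remainder with zero contraction. The
    witness is then halved because [ad_mx] is half a commutator. *)
Lemma so7_split (A : 'M[R]_8) : A^T = - A -> (forall i, ent A 0 i = 0) ->
  exists2 d : oct R, oRe d = 0 & exists2 B, g2_matrix B &
    forall x, x *m A = omul d x - omul x d + x *m B.
Proof.
move=> AT A0.
have [s sE] : exists s : seq R, forall i, (i < 8)%N -> s`_i = 3^-1 *
  rot_axis A 0 (inord i).
  exists (mkseq (fun i => 3^-1 * rot_axis A 0 (inord i)) 8) => i i8.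
  by rewrite nth_mkseq.
pose d := mkoct 0 s`_1 s`_2 s`_3 s`_4 s`_5 s`_6 s`_7.
exists (2^-1 *: d); first by rewrite /d !octE mulr0.
exists (A - ad_mx s); last first.
  by move=> x; rewrite mulmxBr mul_ad_mx omulZl omulZr -scalerBr addrC subrK.
have entB i j : ent (A - ad_mx s) i j = ent A i j - ent (ad_mx s) i j.
  by rewrite /ent !mxE.
split.
- by rewrite linearB /= AT ad_mx_skew opprD.
- move=> i; rewrite entB A0 sub0r /ent mxE inordK //=.
  by case: (inord i) => k kP /=; do 8?[case: k kP => [|k] kP;
    first by rewrite /= oppr0].
rewrite {1}/rot_axis o0_mk !entB !ent_ad_mx //= !sE // /rot_axis !mxE !inordK
  //=.
by apply: mkoct_eq; split; field.
Qed.
End OctonionAlgebra.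

(** * Hermitian matrices and the maps phi_M *)

Section HermitianMatrices.
Variable R : realType.
Implicit Types (a : R).

Lemma M2O_eqP (A B : M2O R) : A 0 0 = B 0 0 -> A 0 1 = B 0 1 ->
  A 1 0 = B 1 0 -> A 1 1 = B 1 1 -> A = B.
Proof.
move=> h00 h01 h10 h11; apply/matrixP => i j.
case: (unliftP 0 i) => [i'|] ->; case: (unliftP 0 j) => [j'|] -> //;
by rewrite ?(ord1 i') ?(ord1 j') //; (suff -> : lift 0 0 = 1 :> 'I_2 by []);
  exact: val_inj.
Qed.

Definition herm (s : R) (x : oct R) (t : R) : M2O R :=
  \matrix_(i, j) if i == 0 then (if j == 0 then oreal s else x)
                 else (if j == 0 then oconj x else oreal t).

Lemma herm_h2 s x t : h2 (herm s x t).
Proof.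
apply: M2O_eqP; rewrite !mxE /= ?oconjK //.
all: by rewrite !octE !oppr0.
Qed.

Lemma h2_herm (X : M2O R) : h2 X -> X =
  herm (oRe (X 0 0)) (X 0 1) (oRe (X 1 1)).
Proof.
have re x : oconj x = x -> x = oreal (oRe x).
  case: (octP x) => x0 x1 x2 x3 x4 x5 x6 x7;
    rewrite !octE => /mkoct_inj[[_ ? ? ?] [? ? ? ?]].
  by apply: mkoct_eq; split => //; lra.
move=> hX; have E i j : oconj (X j i) = X i j by rewrite -[in RHS]hX mxE.
apply: M2O_eqP; rewrite !mxE /= -?re //.
Qed.

Definition xpart (v : 'cV[R]_10) : oct R := \row_k v (inord k.+1) 0.

Lemma h2_of_cVE (v : 'cV[R]_10) : h2_of_cV v =
  herm (v ord0 0 + v ord_max 0) (xpart v) (v ord0 0 - v ord_max 0).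
Proof. by apply/matrixP => i j; rewrite !mxE. Qed.

Lemma ord10P (i : 'I_10) : [\/ i = ord0, i = ord_max | exists k : 'I_8, i =
  inord k.+1].
Proof.
case: (eqVneq i ord0) => [->|i0]; first by constructor 1.
case: (eqVneq i ord_max) => [->|i9]; first by constructor 2.
constructor 3; have i8 : (i.-1 < 8)%N.
  by move: i0 i9 (ltn_ord i); rewrite -!val_eqE /=; lia.
exists (Ordinal i8); apply: val_inj; rewrite /= inordK /=;
by move: i0 i9 (ltn_ord i); rewrite -!val_eqE /=; lia.
Qed.

Lemma sum_ord10 (f : 'I_10 -> R) :
  \sum_i f i = f ord0 + \sum_(k < 8) f (inord k.+1) + f ord_max.
Proof.
rewrite big_ord_recl big_ord_recr /= addrA; congr (_ + f _);
  last exact: val_inj.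
congr (_ + _); apply: eq_bigr => k _; congr (f _); apply: val_inj.
by rewrite /= inordK // /bump /=; have := ltn_ord k; lia.
Qed.

Lemma inord_mid (k : 'I_8) : [/\ (inord k.+1 == ord0 :> 'I_10) = false,
  (inord k.+1 == ord_max :> 'I_10) = false & inord (inord k.+1 : 'I_10).-1 = k].
Proof.
have k8 := ltn_ord k.
have k10 : (k.+1 < 10)%N by lia.
by split; rewrite -?val_eqE /= ?inordK //= ?inord_val //; lia.
Qed.

Lemma h2_of_cVK (v : 'cV[R]_10) : cV_of_h2 (h2_of_cV v) = v.
Proof.
apply/colP => i; rewrite h2_of_cVE !mxE /= !oreal_mk !oRe_mk.
case: (ord10P i) => [->|->|[k ->]].
- by rewrite eqxx; field.
- by rewrite eqxx /=; field.
by have [-> -> ->] := inord_mid k.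
Qed.

Lemma cV_of_h2K (X : M2O R) : h2 X -> h2_of_cV (cV_of_h2 X) = X.
Proof.
move=> /h2_herm {2}->; rewrite h2_of_cVE; congr herm.
- by rewrite !mxE eqxx /=; field.
- apply/rowP => k; rewrite !mxE.
  by have [-> -> ->] := inord_mid k.
- by rewrite !mxE eqxx /=; field.
Qed.

Lemma h2_of_cV_h2 (v : 'cV[R]_10) : h2 (h2_of_cV v).
Proof. by rewrite h2_of_cVE; apply: herm_h2. Qed.

Lemma xpart_linear : linear xpart.
Proof. by move=> a u v; apply/rowP => k; rewrite !mxE. Qed.

Lemma h2_of_cV_linear : linear (@h2_of_cV R).
Proof.
move=> a u v; rewrite !h2_of_cVE; apply: M2O_eqP;
  rewrite !mxE /= ?xpart_linear ?oconj_linear //.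
all: by oct_ring.
Qed.

Lemma cV_of_h2_linear : linear (@cV_of_h2 R).
Proof.
move=> a X Y; apply/colP => i; rewrite !mxE /oRe !mxE; case: ifP => _;
  first by field.
by case: ifP => _ //; field.
Qed.

Lemma h2_matrix_eq (F : M2O R -> M2O R) (A : 'M[R]_10) :
  (forall v, F (h2_of_cV v) = h2_of_cV (A *m v)) -> h2_matrix F = A.
Proof.
move=> FA; apply/matrixP => i j; rewrite mxE FA h2_of_cVK.
by rewrite -[RHS]mulr1 mxE (bigD1 j) //= mxE !eqxx big1 ?addr0 // => k kj;
  rewrite mxE (negPf kj) mulr0.
Qed.

(** [h2_matrix] records only the images of a basis, whence linearity, and reads them through
    [cV_of_h2], which is faithful on Hermitian matrices, whence stability of [h2]. *)
Lemma h2_matrixE (F : M2O R -> M2O R) (Flin : linear F) (Fh2 : forall X,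
  h2 X -> h2 (F X)) v :
  F (h2_of_cV v) = h2_of_cV (h2_matrix F *m v).
Proof.
rewrite -[LHS]cV_of_h2K; last exact/Fh2/h2_of_cV_h2.
congr h2_of_cV.
pose f w := cV_of_h2 (F (h2_of_cV w)).
have flin : linear f.
  by move=> a u w; rewrite /f h2_of_cV_linear Flin cV_of_h2_linear.
pose G : {linear 'cV[R]_10 -> 'cV[R]_10} :=
  HB.pack f (GRing.isLinear.Build _ _ _ _ f flin).
rewrite -[LHS]/(G v) {1}[v]matrix_sum_delta exchange_big big_ord1 linear_sum.
apply/colP => i; rewrite summxE mxE; apply: eq_bigr => j _.
by rewrite linearZ [in LHS]mxE [in RHS]mxE mulrC mxE.
Qed.

End HermitianMatrices.

(** * Closed form of phi_M for Hermitian M *)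

Section PhiHermitian.
Variable R : realType.
Implicit Types (a : R) (A B C M X : M2O R).

Lemma M2O_linE a A B i j : (a *: A + B) i j = a *: A i j + B i j.
Proof. by rewrite !mxE. Qed.

Lemma omulmxE A B i j : omulmx A B i j = omul (A i 0) (B 0 j) +
  omul (A i 1) (B 1 j).
Proof. by rewrite mxE big_ord_recl big_ord1; congr (_ + omul (A i _) (B _ j));
  exact: val_inj. Qed.

Lemma omulmx_linearl C : linear (fun A => omulmx A C).
Proof.
move=> a A B; apply/matrixP => i j; rewrite M2O_linE !omulmxE !M2O_linE.
by rewrite !omulDl !omulZl scalerDr addrACA.
Qed.

Lemma omulmx_linearr C : linear (omulmx C).
Proof.
move=> a A B; apply/matrixP => i j; rewrite M2O_linE !omulmxE !M2O_linE.
by rewrite !omulDr !omulZr scalerDr addrACA.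
Qed.

Lemma odag_linear : linear (@odag R).
Proof.
by move=> a A B; apply/matrixP => i j; rewrite M2O_linE !mxE oconj_linear.
Qed.

Lemma odagK : involutive (@odag R).
Proof. by move=> A; apply/matrixP => i j; rewrite !mxE oconjK. Qed.

Lemma oconjD (x y : oct R) : oconj (x + y) = oconj x + oconj y.
Proof. by rewrite -[x]scale1r oconj_linear !scale1r. Qed.

Lemma odagM A B : odag (omulmx A B) = omulmx (odag B) (odag A).
Proof.
by apply/matrixP => i j; rewrite mxE !omulmxE !mxE oconjD !oconjM.
Qed.

Section Linear.
Variables (U V : lmodType R) (f g : U -> V).
Hypotheses (flin : linear f) (glin : linear g).

Lemma linfD x y : f (x + y) = f x + f y.
Proof. by rewrite -[x in LHS]scale1r flin scale1r. Qed.

Lemma linf0 : f 0 = 0.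
Proof. by apply: (addIr (f 0)); rewrite -linfD !add0r. Qed.

Lemma linfZ a x : f (a *: x) = a *: f x.
Proof. by rewrite -[a *: x]addr0 flin linf0 addr0. Qed.

Lemma linfN x : f (- x) = - f x.
Proof. by rewrite -scaleN1r linfZ scaleN1r. Qed.

Lemma linear_addf : linear (fun x => f x + g x).
Proof. by move=> a x y; rewrite flin glin scalerDr addrACA. Qed.

Lemma linear_scalef c : linear (fun x => c *: f x).
Proof. by move=> a x y; rewrite flin scalerDr !scalerA mulrC. Qed.
End Linear.

Lemma linear_compf (U V W : lmodType R) (f : V -> W) (g : U -> V) :
  linear f -> linear g -> linear (fun x => f (g x)).
Proof. by move=> flin glin a x y; rewrite glin flin. Qed.

Lemma phi_linear M : linear (phi M).
Proof.
apply: linear_scalef; apply: linear_addf.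
- exact: linear_compf (omulmx_linearl _) (omulmx_linearr _).
- exact: linear_compf (omulmx_linearr _) (omulmx_linearl _).
Qed.

Lemma phi_h2 M X : h2 X -> h2 (phi M X).
Proof.
rewrite /h2 /= /phi => hX.
rewrite (linfZ odag_linear) (linfD odag_linear) !odagM odagK hX; congr (_ *: _).
by rewrite addrC.
Qed.

Lemma omul_real_l (a : R) x : omul (oreal a) x = a *: x.
Proof. by case: (octP x) => *; oct_ring. Qed.

Lemma omul_real_r (a : R) x : omul x (oreal a) = a *: x.
Proof. by case: (octP x) => *; oct_ring. Qed.

(** The right side is T M - det(M) adj(X), with T the trace of the Jordan product of M and X and
    adj(X) = tr(X) 1 - X: the formula that Cayley-Hamilton gives for MXM over a commutative ring. In
    the coordinates of R^10, adj is [eta]. *)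
Lemma phi_herm (a b r t : R) (m x : oct R) :
  phi (herm a m b) (herm r x t) =
  let T := a * r + b * t + 2 * odot m x in let q := a * b - onormsq m in
  herm (T * a - q * t) (T *: m + q *: x) (T * b - q * r).
Proof.
rewrite /phi /odot /onormsq; have -> : odag (herm a m b) =
  herm a m b by exact: herm_h2.
case: (octP x) => x0 x1 x2 x3 x4 x5 x6 x7;
  case: (octP m) => m0 m1 m2 m3 m4 m5 m6 m7.
have SE c A i j : (c *: A : M2O R) i j = c *: A i j by rewrite mxE.
have DE A B i j : (A + B : M2O R) i j = A i j + B i j by rewrite mxE.
have h00 s y u : herm s y u 0 0 = oreal s by rewrite mxE.
have h01 s y u : herm s y u 0 1 = y by rewrite mxE.
have h10 s y u : herm s y u 1 0 = oconj y by rewrite mxE.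
have h11 s y u : herm s y u 1 1 = oreal u by rewrite mxE.
apply: M2O_eqP; rewrite SE DE !omulmxE !(h00, h01, h10, h11) /=.
all: rewrite !(omul_real_l, omul_real_r).
all: rewrite !octE.
all: by apply: mkoct_eq; split; field.
Qed.

Lemma xpartD u v : xpart (u + v) = xpart u + xpart v :> oct R.
Proof. exact: (linfD (@xpart_linear R)). Qed.

Lemma xpartZ a v : xpart (a *: v) = a *: xpart v.
Proof. exact: (linfZ (@xpart_linear R)). Qed.

Definition eta : 'M[R]_10 := diag_mx (\row_i if i == ord0 then 1 else -1).

Definition mink (u v : 'cV[R]_10) : R := (u^T *m (eta *m v)) 0 0.

Lemma odotE (x y : oct R) : odot x y = \sum_k x 0 k * y 0 k.
Proof.
rewrite /odot; case: (octP x) => *; case: (octP y) => *; rewrite !octE.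
rewrite !big_ord_recl big_ord0 !mxE /=; ring.
Qed.

Lemma dot_cV10 (u v : 'cV[R]_10) :
  (u^T *m v) 0 0 = u ord0 0 * v ord0 0 + odot (xpart u) (xpart v) +
    u ord_max 0 * v ord_max 0.
Proof.
by rewrite mxE sum_ord10 odotE !mxE; congr (_ + _ + _); apply: eq_bigr => k _;
  rewrite !mxE.
Qed.

Lemma eta_mulE v i : (eta *m v) i 0 = (if i == ord0 then 1 else -1) *
  v i (0 : 'I_1).
Proof. by rewrite mul_diag_mx !mxE. Qed.

End PhiHermitian.

(** * Lorentz matrices and reflections *)

Section Lorentz.
Variable R : realType.
Implicit Types (a : R) (X : M2O R) (u v w m : 'cV[R]_10) (A B : 'M[R]_10).
Local Notation eta := (@eta R).

Lemma xpart_eta v : xpart (eta *m v) = - xpart v.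
Proof.
apply/rowP => k; rewrite mxE eta_mulE [in RHS]mxE [in RHS]mxE.
by have [-> _ _] := inord_mid k; rewrite mulN1r.
Qed.

Lemma odotNr (x y : oct R) : odot x (- y) = - odot x y.
Proof. by rewrite !odotE -sumrN; apply: eq_bigr => k _; rewrite mxE mulrN. Qed.

Lemma minkE u v :
  mink u v = u ord0 0 * v ord0 0 - odot (xpart u) (xpart v) - u ord_max 0 *
    v ord_max 0.
Proof.
by rewrite /mink dot_cV10 xpart_eta odotNr !eta_mulE /= mul1r mulN1r mulrN.
Qed.

Lemma h2det_herm s x t : h2det (herm s x t) = s * t - onormsq x :> R.
Proof. by rewrite /h2det !mxE /= !oreal_mk !oRe_mk. Qed.

Lemma h2detE v : h2det (h2_of_cV v) = mink v v.
Proof. by rewrite h2_of_cVE h2det_herm minkE /odot /onormsq; ring. Qed.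

(* The matrix of phi_M for Hermitian M; up to the sign [mink m m] it is the
   product of the reflections in [m] and in the unit time vector. *)
Definition Umx m : 'M[R]_10 := 2 *: (m *m m^T) - mink m m *: eta.

Lemma Umx_mul m v : Umx m *m v = (2 * (m^T *m v) 0 0) *: m - mink m m *:
  (eta *m v).
Proof.
rewrite mulmxBl -!scalemxAl -mulmxA -scalerA; congr (_ *: _ - _).
by apply/colP => i; rewrite mxE big_ord1 !mxE mulrC.
Qed.

Lemma phi_h2_of_cV m v : phi (h2_of_cV m) (h2_of_cV v) = h2_of_cV (Umx m *m v).
Proof.
rewrite !h2_of_cVE phi_herm Umx_mul /= dot_cV10 minkE -/(odot _ _).
set T := _ + _ + 2 * _; set q := _ * _ - onormsq _.
have -> : 2 * (m ord0 0 * v ord0 0 + odot (xpart m) (xpart v) + m ord_max 0 *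
  v ord_max 0) = T.
  by rewrite /T; ring.
have -> : m ord0 0 * m ord0 0 - odot (xpart m) (xpart m) - m ord_max 0 *
  m ord_max 0 = q.
  by rewrite /q /odot /onormsq; ring.
rewrite xpartD (linfN (@xpart_linear R)) !xpartZ xpart_eta scalerN opprK.
have E i : (T *: m - q *: (eta *m v)) i 0 = T * m i 0 - q *
  ((if i == ord0 then 1 else -1) * v i 0).
  by rewrite mxE mxE mxE [in LHS]mxE eta_mulE.
by rewrite !E /=; congr herm; ring.
Qed.

(** Polarization: once the diagonal terms vanish, the form at e_i + e_j is 2 S_ij. *)
Lemma quad_eq0 n (S : 'M[R]_n) : S^T = S ->
  (forall v : 'cV_n, (v^T *m (S *m v)) 0 0 = 0) -> S = 0.
Proof.
move=> ST S0; apply/matrixP => i j; rewrite [RHS]mxE.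
pose b k l := ((delta_mx k 0)^T *m (S *m (delta_mx l 0 : 'cV_n)) : 'M[R]_1) 0 0.
have bE k l : b k l = S k l.
  by rewrite /b trmx_delta -rowE -colE !mxE.
have := S0 (delta_mx i 0 + delta_mx j 0).
rewrite linearD /= mulmxDr !mulmxDl !mulmxDr mxE [X in X + _]mxE [X in _ +
  X]mxE.
rewrite !S0 -/(b i j) -/(b j i) !bE -{2}ST mxE add0r addr0 => h; lra.
Qed.

Definition lorentz A := A^T *m eta *m A = eta.

Lemma tr_eta : eta^T = eta. Proof. exact: tr_diag_mx. Qed.

Lemma eta_eta : eta *m eta = 1%:M.
Proof.
rewrite mulmx_diag; apply/matrixP => i j; rewrite !mxE.
by case: ifP => _; rewrite ?mulr1 ?mulrNN ?mulr1.
Qed.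

Lemma lorentz_mink A : lorentz A <-> forall v, mink (A *m v) (A *m v) =
  mink v v.
Proof.
split=> [AL v|AL].
  by rewrite /mink trmx_mul !mulmxA -(mulmxA _ A^T) -(mulmxA _ _ A) AL.
apply/eqP; rewrite -subr_eq0; apply/eqP/quad_eq0.
  by rewrite linearB /= !trmx_mul trmxK tr_eta mulmxA.
move=> v; rewrite mulmxBl mulmxBr mxE [X in _ + X]mxE.
have := AL v; rewrite /mink trmx_mul !mulmxA => ->; exact: subrr.
Qed.

Lemma lorentzM A B : lorentz A -> lorentz B -> lorentz (A *m B).
Proof. by move=> hA hB; rewrite /lorentz trmx_mul !mulmxA -(mulmxA _ A^T)
  -(mulmxA _ _ A) hA. Qed.

Lemma lorentz1 : lorentz 1%:M.
Proof. by rewrite /lorentz trmx1 mul1mx mulmx1. Qed.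

Lemma lorentz_inv A : lorentz A -> (eta *m A^T *m eta) *m A = 1%:M.
Proof. by move=> AL; rewrite -!mulmxA (mulmxA A^T) AL eta_eta. Qed.

Lemma lorentz_unit A : lorentz A -> A \in unitmx.
Proof. by move=> /lorentz_inv/mulmx1_unit[]. Qed.

Lemma lorentz_invmx A : lorentz A -> invmx A = eta *m A^T *m eta.
Proof.
move=> AL; rewrite -[RHS](mulmxK (lorentz_unit AL)) lorentz_inv // mul1mx //.
Qed.

Lemma lorentz_V A : lorentz A -> lorentz (invmx A).
Proof.
move=> AL; have AU := lorentz_unit AL;
  rewrite /lorentz -{1}AL !mulmxA -trmx_mul mulmxV // trmx1 mul1mx.
by rewrite mulmxK.
Qed.

(** A left inverse of a square matrix is also a right inverse; so the rows obey the same relations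
    as the columns. *)
Lemma lorentz_T A : lorentz A -> A *m eta *m A^T = eta.
Proof.
move=> AL; have := mulmx1C (lorentz_inv AL); rewrite !mulmxA => h.
by rewrite -[LHS]mulmx1 -eta_eta mulmxA h mul1mx.
Qed.

Lemma minkC u v : mink u v = mink v u.
Proof.
have tr1 (M : 'M[R]_1) : M 0 0 = M^T 0 0 by rewrite mxE.
by rewrite /mink tr1 !trmx_mul trmxK tr_eta mulmxA. Qed.

Lemma minkDr u v w : mink u (v + w) = mink u v + mink u w.
Proof. by rewrite /mink !mulmxDr mxE. Qed.

Lemma minkZr a u v : mink u (a *: v) = a * mink u v.
Proof. by rewrite /mink -!scalemxAr mxE. Qed.

Lemma minkDl u v w : mink (v + w) u = mink v u + mink w u.
Proof. by rewrite !(minkC _ u) minkDr. Qed.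

Lemma minkZl a u v : mink (a *: u) v = a * mink u v.
Proof. by rewrite !(minkC _ v) minkZr. Qed.

Lemma minkNr u v : mink u (- v) = - mink u v.
Proof. by rewrite -scaleN1r minkZr mulN1r. Qed.

Lemma minkNl u v : mink (- u) v = - mink u v.
Proof. by rewrite !(minkC _ v) minkNr. Qed.

Lemma mink_eta u v : mink (eta *m u) (eta *m v) = mink u v.
Proof. by rewrite /mink trmx_mul tr_eta (mulmxA eta) eta_eta mul1mx !mulmxA.
  Qed.

Lemma mink_etar u v : mink u (eta *m v) = (u^T *m v) 0 0.
Proof. by rewrite /mink (mulmxA eta) eta_eta mul1mx. Qed.

Lemma lorentz_minkE A u v : lorentz A -> mink (A *m u) (A *m v) = mink u v.
Proof.
by move=> AL; rewrite /mink trmx_mul !mulmxA -(mulmxA _ A^T) -(mulmxA _ _ A) AL.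
Qed.

Lemma Umx_lorentz m : mink m m ^+ 2 = 1 -> lorentz (Umx m).
Proof.
move=> q1; apply/lorentz_mink => v; rewrite Umx_mul; set c := (m^T *m v) 0 0.
rewrite !(minkDl, minkDr, minkNl, minkNr, minkZl,
  minkZr) (minkC _ m) mink_eta mink_etar -/c.
by rewrite -[RHS]mul1r -[X in _ = X * _]q1; ring.
Qed.

Definition refl u : 'M[R]_10 := 1%:M - (2 / mink u u) *: (u *m (u^T *m eta)).

Lemma refl_mul u v : refl u *m v = v - (2 * mink u v / mink u u) *: u.
Proof.
rewrite mulmxBl mul1mx -scalemxAl -!mulmxA; congr (_ - _).
apply/colP => i; rewrite mxE [in RHS]mxE mxE big_ord1 -/(mink u v).
by ring.
Qed.

Lemma refl_scale a u : a != 0 -> refl (a *: u) = refl u.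
Proof.
move=> a0; rewrite /refl minkZl minkZr [(a *: u)^T]linearZ /= -!scalemxAl
  -!scalemxAr !scalerA.
congr (_ - _ *: _).
have [->|q0] := eqVneq (mink u u) 0; first by rewrite !mulr0 invr0 mulr0 !mul0r.
by field; rewrite a0 q0.
Qed.

Lemma refl_lorentz u : mink u u != 0 -> lorentz (refl u).
Proof.
move=> q0; apply/lorentz_mink => v; rewrite refl_mul.
rewrite !(minkDl, minkDr, minkNl, minkNr, minkZl, minkZr) (minkC v u).
by field.
Qed.

Lemma reflK u : mink u u != 0 -> refl u *m refl u = 1%:M.
Proof.
move=> q0; rewrite -[RHS](lorentz_inv (refl_lorentz q0)); congr (_ *m _).
rewrite {1}/refl (_ : (refl u)^T = 1%:M - (2 / mink u u) *:
  (u *m (u^T *m eta))^T).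
  rewrite (trmx_mul u) trmx_mul trmxK tr_eta mulmxBr mulmxBl mulmx1 eta_eta.
  by rewrite -scalemxAr -scalemxAl !mulmxA eta_eta mul1mx.
by rewrite /refl linearB linearZ /= trmx1.
Qed.

(** The block matrix with rows (1, -c) and (r, 1) factors both as lower times upper and as upper
    times lower triangular; the two sides are its determinant computed in these two ways. *)
Lemma det_rank1 n (c : 'cV[R]_n) (r : 'rV[R]_n) :
  \det (1%:M + c *m r) = 1 + (r *m c) 0 0.
Proof.
have e1 : block_mx 1%:M 0 r 1%:M *m block_mx 1%:M (- c) 0 (1%:M + r *m c) =
  block_mx 1%:M (- c) r 1%:M.
  by rewrite mulmx_block !mul1mx !mul0mx ?mulmx0 !addr0 mulmx1 mulmxN addrC
    addrK.
have e2 : block_mx 1%:M (- c) 0 1%:M *m block_mx (1%:M + c *m r) 0 r 1%:M =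
  block_mx 1%:M (- c) r 1%:M.
  by rewrite mulmx_block !mul1mx !mul0mx ?mulmx0 !add0r mulmx1 mulNmx addrK.
have := congr1 determinant (etrans e1 (esym e2)).
by rewrite !det_mulmx !det_lblock !det_ublock !det1 !mul1r !mulr1 => <-;
  rewrite det_mx11 !mxE eqxx.
Qed.

Lemma det_refl u : mink u u != 0 -> \det (refl u) = -1.
Proof.
move=> q0; rewrite /refl -scaleNr scalemxAl det_rank1 -scalemxAr mxE -mulmxA.
rewrite -/(mink u u) -[X in _ * X]/(mink u u).
by field.
Qed.

(** Up to the factor -q, [Umx u] is a reflection followed by [eta] on the right, while the twist by
    [eta] in the second factor puts its [eta] on the left. The two copies of [eta] cancel and the
    scalars give q^2 = 1. *)
Lemma Umx_refl u w : mink u u = mink w w -> mink u u ^+ 2 = 1 ->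
  Umx u *m Umx (eta *m w) = refl u *m refl w.
Proof.
move=> quw q1; have q0 : mink u u != 0.
  by apply: contra_eq_neq q1 => ->; rewrite expr0n /= eq_sym oner_neq0.
have E1 : Umx u *m eta = - mink u u *: refl u.
  rewrite /Umx mulmxBl -!scalemxAl eta_eta /refl scalerBr scalerA -mulmxA addrC
    !scaleNr; congr (_ + _).
  by rewrite -scaleNr; congr (_ *: _); field.
have E2 : eta *m Umx (eta *m w) = - mink w w *: refl w.
  rewrite /Umx mulmxBr -!scalemxAr eta_eta mink_eta !mulmxA eta_eta mul1mx.
  rewrite /refl scalerBr scalerA trmx_mul tr_eta addrC !scaleNr; congr (_ + _).
  by rewrite -scaleNr mulmxA; congr (_ *: _); rewrite -quw; field.
rewrite -[Umx u]mulmx1 -eta_eta mulmxA -mulmxA E1 E2 -scalemxAl -scalemxAr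
  scalerA.
by rewrite -quw mulrNN -expr2 q1 scale1r.
Qed.

End Lorentz.

(** * The group generated by the admissible maps *)

Section Generation.
Variable R : realType.
Implicit Types (a : R) (X : M2O R) (u v w m : 'cV[R]_10) (A B g h : 'M[R]_10).
Local Notation eta := (@eta R).

Definition phis (s : seq (M2O R)) : M2O R -> M2O R :=
  foldr (fun M F => phi M \o F) idfun s.

Lemma phis_linear s : linear (phis s).
Proof.
elim: s => [|M s IH]; first by move=> a X Y.
exact: linear_compf (phi_linear M) IH.
Qed.

Lemma phis_h2 s X : h2 X -> h2 (phis s X).
Proof. by move=> hX; elim: s => [//|M s IH]; apply: phi_h2. Qed.

(** Words without inverse letters, a priori only a monoid; [phiprod_inv] turns it into the generated
    group. *)
Definition phiprod g := exists2 s : seq (M2O R),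
  (forall M, M \in s -> admissible M) &
  g = h2_matrix (phis s).

Lemma h2_matrix_phis_cat s t :
  h2_matrix (phis (s ++ t)) = h2_matrix (phis s) *m h2_matrix (phis t).
Proof.
apply: h2_matrix_eq => v; rewrite -mulmxA.
rewrite -(h2_matrixE (phis_linear s) (@phis_h2 s))
  -(h2_matrixE (phis_linear t) (@phis_h2 t)).
by elim: s => [//|M s IH] /=; rewrite IH.
Qed.

Lemma phiprod_mul g h : phiprod g -> phiprod h -> phiprod (g *m h).
Proof.
move=> [s sA ->] [t tA ->]; exists (s ++ t); last by rewrite h2_matrix_phis_cat.
by move=> M; rewrite mem_cat => /orP[/sA|/tA].
Qed.

Lemma phiprod1 : phiprod 1%:M.
Proof. by exists [::] => //; apply/esym/h2_matrix_eq => v; rewrite mul1mx. Qed.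

Lemma phiprod_gen (M : M2O R) : admissible M -> phiprod (h2_matrix (phi M)).
Proof.
move=> MA; exists [:: M]; last exact: erefl.
by move=> N; rewrite inE => /eqP ->.
Qed.

Lemma admissible_lorentz (M : M2O R) : admissible M ->
  lorentz (h2_matrix (phi M)).
Proof.
move=> [_ Mdet]; apply/lorentz_mink => v.
rewrite -!h2detE -(h2_matrixE (phi_linear M) (@phi_h2 _ M)).
by rewrite Mdet //; apply: h2_of_cV_h2.
Qed.

Lemma phiprod_lorentz g : phiprod g -> lorentz g.
Proof.
move=> [s sA ->]; elim: s sA => [|M s IH] sA.
  by rewrite (_ : h2_matrix _ = 1%:M);
    [exact: (@lorentz1 R) | apply: h2_matrix_eq => v; rewrite mul1mx].
rewrite -cat1s h2_matrix_phis_cat; apply: lorentzM.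
  by apply: admissible_lorentz; apply: sA; rewrite mem_head.
by apply: IH => N Ns; apply: sA; rewrite in_cons Ns orbT.
Qed.

Lemma admissible_herm m : mink m m ^+ 2 = 1 -> admissible (h2_of_cV m).
Proof.
move=> q1; have PL := Umx_lorentz q1; have PU := lorentz_unit PL; split;
  last first.
  by move=> X /cV_of_h2K <-; rewrite phi_h2_of_cV !h2detE lorentz_minkE.
split.
- by move=> X; apply: phi_h2.
- move=> X Y; rewrite !inE => /cV_of_h2K <- /cV_of_h2K <-;
  rewrite !phi_h2_of_cV.
  by move=> /(congr1 (@cV_of_h2 R));
    rewrite !h2_of_cVK => /(can_inj (mulKmx PU)) ->.
- move=> X /cV_of_h2K <-; exists (h2_of_cV (invmx (Umx m) *m cV_of_h2 X)).
    exact: h2_of_cV_h2.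
  by rewrite phi_h2_of_cV mulKVmx.
Qed.

Lemma phiprod_Umx m : mink m m ^+ 2 = 1 -> phiprod (Umx m).
Proof.
move=> q1; rewrite -(h2_matrix_eq (phi_h2_of_cV m));
  exact/phiprod_gen/admissible_herm.
Qed.

Lemma phiprod_refl2 u w : 0 < mink u u * mink w w -> phiprod (refl u *m refl w).
Proof.
move=> q0; have qu0 : mink u u != 0 by apply: contraTneq q0 => ->;
  rewrite mul0r ltxx.
have qw0 : mink w w != 0 by apply: contraTneq q0 => ->; rewrite mulr0 ltxx.
(* A reflection depends only on the line of its vector. Normalizing u and w replaces their quadratic
   values by the signs, which agree because the product is positive. *)
pose n v := (Num.sqrt `|mink v v|)^-1.
have nE v : mink v v != 0 -> n v != 0 /\ mink (n v *: v) (n v *: v) =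
  Num.sg (mink v v).
  move=> qv0; have sv : Num.sqrt `|mink v v| != 0 by rewrite sqrtr_eq0 -ltNge
    normr_gt0.
  split; first by rewrite invr_eq0.
  rewrite minkZl minkZr mulrA /n -expr2 exprVn sqr_sqrtr // {2}[mink v v]numEsg.
  by rewrite mulrCA mulVf ?mulr1 // normr_eq0.
have [nu0 nu] := nE u qu0; have [nw0 nw] := nE w qw0.
rewrite -(refl_scale u nu0) -(refl_scale w nw0).
have sE : Num.sg (mink u u) = Num.sg (mink w w).
  have [hu|hu|hu] := ltgtP 0 (mink u u).
  - by move: q0; rewrite pmulr_rgt0 // => hw; rewrite !gtr0_sg.
  - by move: q0; rewrite nmulr_rgt0 // => hw; rewrite !ltr0_sg.
  - by rewrite -hu eqxx in qu0.
have s1 v : mink v v != 0 -> Num.sg (mink v v) ^+ 2 = 1 by move=> qv0;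
  rewrite sqr_sg qv0.
rewrite -Umx_refl; last 2 first.
- by rewrite nu nw.
- by rewrite nu s1.
by apply: phiprod_mul; apply: phiprod_Umx; rewrite ?mink_eta ?nu ?nw s1.
Qed.

Definition spacelike (u : 'cV[R]_10) := mink u u < 0.

(** Each reflection has determinant -1, so the number of factors is even and they can be removed two
    at a time by [phiprod_refl2]. *)
Lemma spacelike_prod (s : seq 'cV[R]_10) : all spacelike s ->
  0 < \det (\prod_(u <- s) refl u) -> phiprod (\prod_(u <- s) refl u).
Proof.
have [n] := ubnP (size s); elim: n s => // n IH [|u [|w s]] /= sn.
- by rewrite !big_nil => _ _; exact: phiprod1.
- rewrite !big_cons big_nil mulr1 andbT => su; rewrite det_refl ?lt_eqF //.
  by rewrite ltr0N1.
move=> /and3P[su sw ss]; rewrite !big_cons mulrA => d0.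
apply: phiprod_mul; first by apply: phiprod_refl2; rewrite nmulr_rgt0.
apply: IH => //; first by rewrite -ltnS; exact: ltnW.
by move: d0; rewrite det_mulmx det_mulmx !det_refl ?lt_eqF // mulrNN mul1r
  mul1r.
Qed.

Lemma minkS u v : mink u v = \sum_i (if i == ord0 then 1 else -1) *
  (u i 0 * v i 0).
Proof. by rewrite /mink mxE; apply: eq_bigr => i _;
  rewrite mxE eta_mulE mulrCA. Qed.

Lemma minkS0 u v : mink u v =
  u ord0 0 * v ord0 0 - \sum_(k < 9) u (lift ord0 k) 0 * v (lift ord0 k) 0.
Proof.
rewrite minkS big_ord_recl /= mul1r -sumrN; congr (_ + _).
by apply: eq_bigr => k _; rewrite mulN1r.
Qed.

Lemma mink_lt0 v : v ord0 0 = 0 -> v != 0 -> mink v v < 0.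
Proof.
move=> v0 vn0; rewrite minkS0 v0 mul0r add0r oppr_lt0 lt_neqAle.
have ge0 (k : 'I_9) : true -> 0 <= v (lift ord0 k) 0 * v (lift ord0 k) 0.
  by rewrite -expr2 sqr_ge0.
rewrite sumr_ge0 // andbT eq_sym; apply: contraNneq vn0 => /eqP.
rewrite psumr_eq0 // => /allP vk0; apply/eqP/colP => i; rewrite [RHS]mxE.
case: (unliftP ord0 i) => [k|] -> //.
by have := vk0 k (mem_index_enum _); rewrite mulf_eq0 orbb => /eqP.
Qed.

Local Notation e i := (delta_mx i 0 : 'cV[R]_10).

Lemma mink_e i v : mink (e i) v = (if i == ord0 then 1 else -1) * v i 0.
Proof. by rewrite /mink trmx_delta -rowE mxE eta_mulE. Qed.

Lemma mul_e g i : g *m e i = col i g.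
Proof. by rewrite colE. Qed.

(** Equal quadratic values give 2 [mink (u - v) u] = [mink (u - v) (u - v)], so the reflection
    subtracts exactly u - v from u. *)
Lemma refl_swap u v : mink u u = mink v v -> mink (u - v) (u - v) != 0 ->
  refl (u - v) *m u = v.
Proof.
move=> quv q0; rewrite refl_mul (_ : _ / _ = 1) ?scale1r ?subKr //.
apply: (mulIf q0); rewrite mul1r mulfVK //.
rewrite !(minkDl, minkDr, minkNl, minkNr) (minkC v u) -quv; ring.
Qed.

Lemma refl_fix u v : mink u v = 0 -> refl u *m v = v.
Proof. by move=> uv0; rewrite refl_mul uv0 mulr0 mul0r scale0r subr0. Qed.

(** Induction on the number n of basis vectors not yet known to be fixed. As e_0 is fixed, w = g e_k
    - e_k is orthogonal to e_0, hence spacelike if nonzero, so isotropic differences cannot occur.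
    The reflection in w sends g e_k to e_k and keeps every earlier basis vector. *)
Lemma spacelike_factor n k g : (n + k = 10)%N -> (0 < k)%N -> lorentz g ->
  (forall j : 'I_10, (j < k)%N -> g *m e j = e j) ->
  exists2 s, all spacelike s & g = \prod_(u <- s) refl u.
Proof.
elim: n k g => [|n IH] k g nk k0 gL gfix.
  exists [::] => //; rewrite big_nil; apply/matrixP => i j.
  have /matrixP/(_ i 0) : g *m e j = e j by apply: gfix; rewrite add0n in nk;
    rewrite nk.
  by rewrite mul_e !mxE eqxx andbT.
have k10 : (k < 10)%N by rewrite -nk; lia.
pose i := Ordinal k10; pose v := g *m e i.
have fixS h : (forall j : 'I_10, (j < k)%N -> h *m e j = e j) -> h *m e i =
  e i ->
    forall j : 'I_10, (j < k.+1)%N -> h *m e j = e j.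
  move=> hfix hi j; rewrite ltnS leq_eqVlt => /orP[/eqP jk|/hfix //].
  by rewrite (_ : j = i) //; apply: val_inj.
have nk' : (n + k.+1 = 10)%N by rewrite addnS -addSn.
have [vE|vn] := eqVneq v (e i).
  by apply: (IH k.+1) => //; apply: fixS.
pose w := v - e i.
have wfix (j : 'I_10) : (j < k)%N -> mink w (e j) = 0.
  move=> jk; rewrite /w minkDl minkNl /v -{1}(gfix j jk) lorentz_minkE //;
    exact: subrr.
have wq : mink w w < 0.
  apply: mink_lt0; last by rewrite subr_eq0.
  by have := wfix ord0 k0; rewrite minkC mink_e eqxx mul1r.
have wq0 : mink w w != 0 by rewrite lt_eqF.
have [||s sS sE] := IH k.+1 (refl w *m g) nk' isT.
- exact: lorentzM (refl_lorentz wq0) gL.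
- apply: fixS => [j jk|]; first by rewrite -mulmxA gfix // refl_fix // wfix.
  by rewrite -mulmxA; apply: refl_swap => //; rewrite lorentz_minkE.
exists (w :: s); first by rewrite /= sS andbT.
by rewrite big_cons -sE -[RHS]/(refl w *m (refl w *m g)) mulmxA reflK // mul1mx.
Qed.

(* After the product of reflections taking [g *m e_0] back to [e_0], only
   spacelike reflections remain, and the determinant makes them even in number. *)
Lemma phiprod_SO g : lorentz g -> 0 < g ord0 ord0 -> 0 < \det g -> phiprod g.
Proof.
move=> gL g00 gdet; pose v := g *m e ord0; pose u := v + e ord0.
have q1 : mink (e ord0) (e ord0) = 1 by rewrite mink_e !mxE !eqxx mulr1.
have qv : mink v v = 1 by rewrite lorentz_minkE.
(* The sum v + e_0 is certain to be timelike, its value being 2 + 2 g_00. Its reflection sends v to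
   -e_0, and the reflection in e_0 corrects the sign. *)
have qu : 0 < mink u u.
  rewrite /u !(minkDl, minkDr) qv q1 (minkC v) mink_e eqxx mul1r /v mul_e mxE;
    lra.
have qu0 : mink u u != 0 by rewrite gt_eqF.
have uv : refl u *m v = - e ord0.
  have := @refl_swap v (- e ord0); rewrite opprK; apply=> //.
  by rewrite qv minkNl minkNr opprK.
have rL : lorentz (refl (e ord0)) by apply: refl_lorentz; rewrite q1 oner_neq0.
pose h := refl (e ord0) *m (refl u *m g).
have hL : lorentz h by apply: lorentzM => //; apply: lorentzM => //;
  exact: refl_lorentz.
have he : h *m e ord0 = e ord0.
  rewrite /h -(mulmxA (refl (e ord0))) -(mulmxA (refl u)) -/v uv mulmxN
    refl_mul q1.
  by rewrite mulr1 divr1 opprB scaler_nat mulr2n addrK.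
have [|s sS sE] := @spacelike_factor 9 1 h erefl isT hL.
  by move=> j; rewrite ltnS leqn0 => /eqP j0; rewrite (_ : j = ord0) //;
    apply: val_inj.
have -> : g = refl u *m refl (e ord0) *m h.
  by rewrite /h mulmxA -(mulmxA (refl u)) reflK ?q1 ?oner_neq0 // mulmx1 mulmxA
    reflK // mul1mx.
apply: phiprod_mul; first by apply: phiprod_refl2; rewrite q1 mulr1.
rewrite sE; apply: spacelike_prod => //;
  rewrite -sE /h !det_mulmx !det_refl ?q1 ?oner_neq0 //.
by rewrite mulrA mulrNN !mul1r.
Qed.

Lemma lorentz_det g : lorentz g -> \det g ^+ 2 = 1.
Proof.
move=> gL; have := congr1 determinant (lorentz_inv gL).
rewrite !det_mulmx det_tr det1 mulrAC -mulrA mulrACA => <-.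
have := congr1 determinant (@eta_eta R); rewrite det_mulmx det1 => ee.
by rewrite mulrC -[LHS]mulr1 -ee; ring.
Qed.

(** The first row and the first column both have spatial square sum g_00^2 - 1. Expanding the sum of
    the (g_0k + g_k0)^2 then bounds the sum of the g_0k g_k0 below by 1 - g_00^2, so the entry is at
    least 1. *)
Lemma lorentz_sqr00 g : lorentz g -> 0 < (g *m g) ord0 ord0.
Proof.
move=> gL.
have c1 := lorentz_minkE (e ord0) (e ord0) gL.
have /matrixP/(_ ord0 ord0) := lorentz_T gL.
rewrite mxE big_ord_recl /= => r1.
have r2 : g ord0 ord0 ^+ 2 - \sum_(k < 9) g ord0 (lift ord0 k) ^+ 2 = 1.
  have -> : 1 = eta ord0 ord0 by rewrite !mxE !eqxx.
  rewrite -r1 -sumrN; congr (_ + _);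
    first by rewrite mul_mx_diag !mxE eqxx mulr1.
  by apply: eq_bigr => k _; rewrite mul_mx_diag !mxE /= mulrN1 mulNr.
have c2 : g ord0 ord0 ^+ 2 - \sum_(k < 9) g (lift ord0 k) ord0 ^+ 2 = 1.
  have -> : 1 = mink (e ord0) (e ord0) by rewrite mink_e !mxE !eqxx mulr1.
  rewrite -c1 minkS0 mul_e !mxE; congr (_ - _).
  by apply: eq_bigr => k _; rewrite !mxE.
rewrite mxE big_ord_recl /=.
have : 0 <= \sum_(k < 9) (g ord0 (lift ord0 k) + g (lift ord0 k) ord0) ^+ 2.
  by apply: sumr_ge0 => k _; rewrite sqr_ge0.
rewrite (eq_bigr _ (fun k _ => sqrrD _ _)) !big_split /=.
set s1 := \sum_(k < 9) g ord0 (lift ord0 k) ^+ 2 in r2 *.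
set s2 := \sum_(k < 9) g (lift ord0 k) ord0 ^+ 2 in c2 *.
by set s3 := \sum_(k < 9) _; rewrite -expr2 => ?; lra.
Qed.

(* The square of a Lorentz matrix is in the identity component, so
   [invmx g = g *m (invmx g) ^ 2] is a product of generators. *)
Lemma phiprod_inv g : phiprod g -> phiprod (invmx g).
Proof.
move=> gG; have gL := phiprod_lorentz gG; have gU := lorentz_unit gL.
have hL := lorentz_V gL; have hU := lorentz_unit hL.
have -> : invmx g = g *m (invmx g *m invmx g) by rewrite mulKVmx.
apply: phiprod_mul => //; apply: phiprod_SO (lorentzM hL hL) (lorentz_sqr00 hL)
  _.
by rewrite det_mulmx -expr2 lorentz_det.
Qed.

Lemma phiprod_GL : @is_GL_subgroup R 10 phiprod.
Proof.
split; [by move=> g /phiprod_lorentz/lorentz_unit | exact: phiprod1 |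
  exact: phiprod_mul | exact: phiprod_inv].
Qed.

Lemma SL2O_phiprod : @SL2O R = phiprod.
Proof.
apply/seteqP; split => [g|g].
  by apply; split; [exact: phiprod_GL | move=> _ [M MA <-]; exact: phiprod_gen].
move=> [s sA ->] G [[_ G1 GM _] Ggen].
elim: s sA => [|M s IH] sA.
  by rewrite (_ : h2_matrix _ = 1%:M) //; apply: h2_matrix_eq => v;
    rewrite mul1mx.
rewrite -cat1s h2_matrix_phis_cat; apply: GM.
  by apply: Ggen; exists M => //; apply: sA; rewrite mem_head.
by apply: IH => N Ns; apply: sA; rewrite in_cons Ns orbT.
Qed.

End Generation.

(** * Smooth maps *)

Section NearDifferentiable.
Variables (R : realType) (V W : normedModType R).

(** The differential is selected by choice, so a candidate, here the zero map, must be exhibited.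
    Locality of differentiability follows by writing g as f + (g - f). *)
Lemma near0_differentiable (h : V -> W) (x : V) :
  (\near x, h x = 0) -> differentiable h x.
Proof.
move=> h0; apply/diffP => /=.
apply: (@getPex _ (fun (df : {linear V -> W}) => continuous df /\
  forall y, h y = h (lim (nbhs x)) + df (y - lim (nbhs x))
                  +o_(y \near x) (y - lim (nbhs x)))).
exists (\0 : {linear V -> W}); split; first by move=> y; exact: cvg_cst.
apply: eqaddoEx => z; rewrite lim_id //= addr0.
have hx : h x = 0 by exact: nbhs_singleton h0.
have h_small (eps : R) : 0 < eps -> \forall y \near x, `|h y| <= eps *
  `|center x y|.
  move=> e0; near=> y; rewrite (_ : h y = 0); last by near: y.
  by rewrite normr0 mulr_ge0 // ltW.
have ho := (@eqoP _ _ _ _ (nbhs x) (center x) h).2 h_small.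
by rewrite hx add0r {1}ho.
Unshelve. all: by end_near. Qed.

Lemma near_differentiable (f g : V -> W) (x : V) :
  (\near x, f x = g x) -> differentiable f x -> differentiable g x.
Proof.
move=> fg df; have -> : g = f + (g - f) by rewrite addrC subrK.
apply: differentiableD => //; apply: near0_differentiable.
near=> y; rewrite -[LHS]/(g y - f y) (_ : f y = g y) ?subrr //.
by near: y.
Unshelve. all: by end_near. Qed.
End NearDifferentiable.

(** * Calculus of C^k maps on an open set *)

Section Ck.
Variables (R : realType) (V : normedModType R) (U : set V).
Hypothesis U_open : open U.

(** The differentiation rules below give equalities on U only; openness of U is what lets such an
    equality pass to derivatives. *)
Lemma Ck_ext (W : normedModType R) k (f g : V -> W) :
  (forall x, U x -> f x = g x) -> Ck_on k U f -> Ck_on k U g.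
Proof.
have nearU x (P : V -> Prop) : U x -> (forall y, U y -> P y) -> \near x, P x.
  by move=> Ux UP; apply: filterS UP _; apply: open_nbhs_nbhs.
elim: k f g => [|k IH] f g fg /=.
  move=> fc x Ux; have fx : f y @[y --> x] --> f x := fc x Ux.
  suff : g y @[y --> x] --> g x by []; rewrite -(fg x Ux); move: fx.
  by apply: cvg_trans; apply: near_eq_cvg; apply: nearU Ux _ => y Uy;
    rewrite fg.
move=> [fd fD]; split=> [x Ux|v].
  by apply: near_differentiable (fd x Ux); apply: nearU fg.
apply: IH (fD v) => x Ux; apply: near_eq_derive.
exact: nearU fg.
Qed.

Lemma CkS (W : normedModType R) k (f : V -> W) : Ck_on k.+1 U f -> Ck_on k U f.
Proof.
elim: k f => [|k IH] f [fd fD].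
  by move=> x Ux; apply/differentiable_continuous/fd.
by split=> // v; apply: IH.
Qed.

Lemma Ck_cst (W : normedModType R) k (c : W) : Ck_on k U (fun=> c).
Proof.
elim: k c => [|k IH] c; first by move=> x _; exact: cvg_cst.
split=> [x _|v]; first exact: differentiable_cst.
by apply: Ck_ext (IH 0) => x _; rewrite -[LHS](derive_cst c x v).
Qed.

Lemma CkD (W : normedModType R) k (f g : V -> W) :
  Ck_on k U f -> Ck_on k U g -> Ck_on k U (fun x => f x + g x).
Proof.
elim: k f g => [|k IH] f g.
  by move=> fc gc x Ux; exact: cvgD (fc x Ux) (gc x Ux).
move=> [fd fD] [gd gD]; split=> [x Ux|v].
  exact: differentiableD (fd x Ux) (gd x Ux).
apply: Ck_ext (IH _ _ (fD v) (gD v)) => x Ux.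
by rewrite -[LHS](deriveD (diff_derivable (fd x Ux))
  (diff_derivable (gd x Ux))).
Qed.

Lemma CkM k (f g : V -> R) :
  Ck_on (W := R^o) k U f -> Ck_on (W := R^o) k U g ->
    Ck_on (W := R^o) k U (fun x => f x * g x).
Proof.
elim: k f g => [|k IH] f g.
  by move=> fc gc x Ux; exact: cvgM (fc x Ux) (gc x Ux).
move=> fk gk; have [fd fD] := fk; have [gd gD] := gk; split=> [x Ux|v].
  exact: differentiableM (fd x Ux) (gd x Ux).
apply: Ck_ext (CkD (IH _ _ (CkS fk) (gD v)) (IH _ _ (CkS gk) (fD v))) => x Ux.
by rewrite -[LHS](deriveM (diff_derivable (fd x Ux))
  (diff_derivable (gd x Ux))).
Qed.

(** Bootstrap: the derivative of 1/f is -(1/f)^2 f', where 1/f is C^k by the induction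
    hypothesis. *)
Lemma CkV k (f : V -> R) : (forall x, U x -> f x != 0) ->
  Ck_on (W := R^o) k U f -> Ck_on (W := R^o) k U (fun x => (f x)^-1).
Proof.
move=> f0; elim: k => [|k IH].
  by move=> fc x Ux; exact: cvgV (f0 x Ux) (fc x Ux).
move=> fk; have [fd fD] := fk; split=> [x Ux|v].
  exact: differentiableV (fd x Ux) (f0 x Ux).
have fVk := IH (CkS fk).
apply: Ck_ext (CkM (CkM (Ck_cst k (-1 : R^o)) (CkM fVk fVk)) (fD v)) => x Ux.
rewrite -[RHS]/('D_v (fun y => (f y)^-1) x)
  (deriveV (f0 x Ux) (diff_derivable (fd x Ux))).
by rewrite mulN1r expr2 invfM.
Qed.

Lemma CkZl (W : normedModType R) k (f : V -> R) (w : W) :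
  Ck_on (W := R^o) k U f -> Ck_on k U (fun x => f x *: w).
Proof.
elim: k f => [|k IH] f.
  by move=> fc x Ux; exact: cvgZr_tmp (fc x Ux).
move=> [fd fD]; split=> [x Ux|v].
  exact: differentiableZl (fd x Ux).
apply: Ck_ext (IH _ (fD v)) => x Ux.
apply/esym/cvg_lim => //=.
have fv : (h^-1 *: ((f \o shift x) (h *: v) - f x)) @[h --> 0^'] -->
  ('D_v f x : R^o).
  exact: (diff_derivable (fd x Ux)).
have := cvgZr_tmp (a := w) fv; move=> /(_ (dnbhs_filter _)).
apply: cvg_trans; apply: near_eq_cvg; near=> h.
by rewrite /= -scalerBl scalerA.
Unshelve. all: by end_near. Qed.

Lemma Ck_sum (W : normedModType R) k (I : Type) (r : seq I) (P : pred I) (f :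
  I -> V -> W) :
  (forall i, P i -> Ck_on k U (f i)) ->
    Ck_on k U (fun x => \sum_(i <- r | P i) f i x).
Proof.
move=> fk; elim: r => [|i r IH].
  by apply: Ck_ext (Ck_cst k 0) => x _; rewrite big_nil.
case Pi : (P i).
  by apply: Ck_ext (CkD (fk i Pi) IH) => x _; rewrite big_cons Pi.
by apply: Ck_ext IH => x _; rewrite big_cons Pi.
Qed.

Lemma Ck_prod k (I : Type) (r : seq I) (P : pred I) (f : I -> V -> R) :
  (forall i, P i -> Ck_on (W := R^o) k U (f i)) ->
  Ck_on (W := R^o) k U (fun x => \prod_(i <- r | P i) f i x).
Proof.
move=> fk; elim: r => [|i r IH].
  by apply: Ck_ext (Ck_cst k (1 : R^o)) => x _; rewrite big_nil.
case Pi : (P i).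
  by apply: Ck_ext (CkM (fk i Pi) IH) => x _; rewrite big_cons Pi.
by apply: Ck_ext IH => x _; rewrite big_cons Pi.
Qed.

Lemma Ck_lin (W : normedModType R) k (f : V -> W) : linear f -> continuous f ->
  Ck_on k U f.
Proof.
move=> flin fc; case: k => [|k]; first by move=> x _; exact: fc.
pose L : {linear V -> W} := HB.pack f (GRing.isLinear.Build _ _ _ _ f flin).
have Ld x : differentiable f x by exact: (@linear_differentiable _ _ _ L).
split=> // v; apply: Ck_ext (Ck_cst k (f v)) => x _.
by rewrite deriveE // (@diff_lin _ _ _ L).
Qed.

End Ck.

(** * Matrix-valued C^k maps *)

Section CkMatrix.
Variables (R : realType) (V : normedModType R) (U : set V).
Hypothesis U_open : open U.

(** Entrywise, products, determinants and inverses reduce to the scalar rules; [Ckmx_Ck] returns to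
    the normed space of matrices. *)
Definition Ckmx k m n (F : V -> 'M[R]_(m, n)) :=
  forall i j, Ck_on (W := R^o) k U (fun x => F x i j).

Lemma Ckmx_Ck k m n (F : V -> 'M[R]_(m, n)) : Ckmx k F -> Ck_on k U F.
Proof.
move=> Fk.
apply: (Ck_ext U_open (f := fun x => \sum_i \sum_j F x i j *: delta_mx i j)).
  by move=> x _; rewrite -matrix_sum_delta.
apply: Ck_sum => // i _; apply: Ck_sum => // j _; exact: CkZl.
Qed.

Lemma Ckmx_cst k m n (A : 'M[R]_(m, n)) : Ckmx k (fun=> A).
Proof. by move=> i j; apply: Ck_cst. Qed.

Lemma CkmxD k m n (F G : V -> 'M[R]_(m, n)) :
  Ckmx k F -> Ckmx k G -> Ckmx k (fun x => F x + G x).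
Proof.
move=> Fk Gk i j; apply: (Ck_ext U_open _ (CkD U_open (Fk i j) (Gk i j))) =>
  x _.
by rewrite mxE.
Qed.

Lemma CkmxM k m n p (F : V -> 'M[R]_(m, n)) (G : V -> 'M[R]_(n, p)) :
  Ckmx k F -> Ckmx k G -> Ckmx k (fun x => F x *m G x).
Proof.
move=> Fk Gk i j.
apply: (Ck_ext U_open (f := fun x => \sum_l F x i l * G x l j)).
  by move=> x _; rewrite mxE.
by apply: (Ck_sum U_open) => // l _; apply: CkM.
Qed.

Lemma CkmxN k m n (F : V -> 'M[R]_(m, n)) : Ckmx k F -> Ckmx k (fun x => - F x).
Proof.
move=> Fk i j; apply: (Ck_ext U_open _
  (CkM U_open (Ck_cst U_open k (-1 : R^o)) (Fk i j))) => x _.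
by rewrite mxE mulN1r.
Qed.

Lemma Ckmx_det k n (F : V -> 'M[R]_n) :
  Ckmx k F -> Ck_on (W := R^o) k U (fun x => \det (F x)).
Proof.
move=> Fk; apply: (Ck_sum U_open) => // s _; apply: CkM => //.
  exact: (Ck_cst U_open k (_ : R^o)).
by apply: Ck_prod => // i _; apply: Fk.
Qed.

(** Cofactor formula: each entry of the inverse is a minor, up to sign, over the determinant. *)
Lemma Ckmx_invmx k n (F : V -> 'M[R]_n) : (forall x, U x -> \det (F x) != 0) ->
  Ckmx k F -> Ckmx k (fun x => invmx (F x)).
Proof.
move=> F0 Fk i j.
apply: (Ck_ext U_open (f := fun x => (\det (F x))^-1 *
    ((-1) ^+ (j + i) * \det (row' j (col' i (F x)))))).
  by move=> x Ux; rewrite /invmx unitmxE unitfE F0 // !mxE.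
apply: CkM => //; first by apply: CkV => //; exact: Ckmx_det.
apply: CkM => //; first exact: (Ck_cst U_open k (_ : R^o)).
apply: Ckmx_det => i' j'.
by apply: (Ck_ext U_open _ (Fk (lift j i') (lift i j'))) => x _; rewrite !mxE.
Qed.

End CkMatrix.

(** Chart domains are cut out by successive inequalities, each function being continuous on the set
    obtained so far; nonvanishing is expressed as positivity of a square. *)
Lemma open_gt0 (R : realType) (V : normedModType R) (U : set V) (f : V -> R) :
  open U -> Ck_on (W := R^o) 0 U f -> open [set x | U x /\ 0 < f x].
Proof.
move=> U_open fc; rewrite openE => x [Ux fx].
have fxc : f y @[y --> x] --> f x := fc x Ux.
have gt0 : \forall y \near x, 0 < f y.
  exact: (cvgr_gt _ fxc).
by apply: filterS2 gt0 (open_nbhs_nbhs (conj U_open Ux)).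
Qed.

Section Coord.
Variables (R : realType) (m n : nat).

Lemma Ckmx_id k (U : set 'M[R]_(m, n)) : open U -> Ckmx U k id.
Proof.
move=> U_open i j; apply: Ck_lin => //; last exact: coord_continuous.
by move=> a A B; rewrite !mxE.
Qed.

End Coord.

Lemma smooth_mulmx (R : realType) n (S : set ('M[R]_n * 'M[R]_n)) :
  smooth_along S (fun gh => gh.1 *m gh.2).
Proof.
move=> p _; exists setT, (fun gh => gh.1 *m gh.2); split => //;
  first exact: openT.
have oT := @openT ('M[R]_n * 'M[R]_n)%type.
move=> k; apply: (Ckmx_Ck oT).
apply: (CkmxM oT) => i j; apply: (Ck_lin oT) => [a [A B] [C D]|x];
  rewrite /= ?mxE //.
- apply: (@cvg_comp _ _ _ (fun z : (_ * _)%type => z.1) (fun M : 'M[R]_n =>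
  M i j)); [exact: cvg_fst | exact: coord_continuous].
- apply: (@cvg_comp _ _ _ (fun z : (_ * _)%type => z.2) (fun M : 'M[R]_n =>
  M i j)); [exact: cvg_snd | exact: coord_continuous].
Qed.

(** * Lie group structure and Lie algebra *)

Section Cayley.
Variables (R : realType) (n : nat).
Implicit Types (y g : 'M[R]_n).

Definition cayley y := (1%:M + y) *m invmx (1%:M - y).
Definition icayley g := (g - 1%:M) *m invmx (g + 1%:M).

(** The Cayley relation between g and y reads (g + 1)(1 - y) = 2: each factor is invertible, with
    half of the other as inverse. *)
Lemma inv_2mx (A B : 'M[R]_n) : A *m B = 2 *: 1%:M ->
  A \in unitmx /\ invmx A = 2^-1 *: B.
Proof.
move=> AB; have AB1 : A *m (2^-1 *: B) = 1%:M.
  by rewrite -scalemxAr AB scalerA mulVf ?scale1r // pnatr_eq0.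
have [AU _] := mulmx1_unit AB1; split => //.
by rewrite -[LHS]mulmx1 -AB1 mulKmx.
Qed.

Lemma halfD y : 2^-1 *: (y + y) = y.
Proof. by rewrite scalerDr -scalerDl -[in RHS](scale1r y); congr (_ *: _);
  field. Qed.

Lemma cayleyK y : 1%:M - y \in unitmx -> cayley y + 1%:M \in unitmx /\
  icayley (cayley y) = y.
Proof.
move=> yU; have gE : cayley y *m (1%:M - y) = 1%:M + y by rewrite mulmxKV.
have [|gU gV] := @inv_2mx (cayley y + 1%:M) (1%:M - y).
  by rewrite mulmxDl gE mul1mx addrACA subrr addr0 scaler_nat mulr2n.
split => //; rewrite /icayley gV -scalemxAr mulmxBl gE mul1mx opprB.
rewrite [1%:M + y]addrC addrACA subrr addr0.
exact: halfD.
Qed.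

Lemma icayleyK g : g + 1%:M \in unitmx -> 1%:M - icayley g \in unitmx /\
  cayley (icayley g) = g.
Proof.
move=> gU; have yE : icayley g *m (g + 1%:M) = g - 1%:M by rewrite mulmxKV.
have [|yU yV] := @inv_2mx (1%:M - icayley g) (g + 1%:M).
  by rewrite mulmxBl yE mul1mx opprB [g +
    _]addrC addrACA subrr addr0 scaler_nat mulr2n.
split => //; rewrite /cayley yV -scalemxAr mulmxDl yE mul1mx.
rewrite addrACA subrr addr0.
exact: halfD.
Qed.
End Cayley.

(** * Slice charts and the Lie group structure *)

Section Lie.
Variable R : realType.
Local Notation eta := (@eta R).
Local Notation M10 := 'M[R]_10.
Implicit Types (y g A p : M10).

(** As [eta] is symmetric, this is twice the symmetric part of [eta *m y]; its kernel is so(9,1). *)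
Definition so_defect y : M10 := y^T *m eta + eta *m y.

Lemma so_defect_linear : linear so_defect.
Proof.
move=> a A B; rewrite /so_defect linearP mulmxDl mulmxDr -scalemxAl -scalemxAr
  addrACA.
by rewrite scalerDr.
Qed.

(** The values of [eta] on 1 + y and on 1 - y differ by 2 [so_defect y], and the Cayley transform
    carries 1 - y to 1 + y. *)
Lemma so_defect_cayley y : 1%:M - y \in unitmx -> so_defect y = 0 ->
  lorentz (cayley y).
Proof.
move=> yU so_y; have gE : cayley y *m (1%:M - y) = 1%:M + y by rewrite mulmxKV.
have yUT : (1%:M - y)^T \in unitmx by rewrite unitmx_tr.
have key : (cayley y *m (1%:M - y))^T *m eta *m (cayley y *m (1%:M - y)) =
  (1%:M - y)^T *m eta *m (1%:M - y).
  have tP : (1%:M + y)^T = 1%:M + y^T by rewrite linearD /= trmx1.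
  have tM : (1%:M - y)^T = 1%:M - y^T by rewrite linearB /= trmx1.
  rewrite gE tP tM.
  rewrite !(mulmxDl, mulmxDr, mulNmx, mulmxN, mul1mx, mulmx1) ?opprD ?opprK.
  have -> : y^T *m eta = - (eta *m y) by apply/eqP; rewrite -addr_eq0;
    apply/eqP.
  rewrite !mulNmx; move: (eta *m y *m y) (eta *m y) => B A.
  by apply/matrixP => i j; rewrite !mxE; ring.
apply: (can_inj (mulKmx yUT)); apply: (can_inj (mulmxK yU)) => /=.
by rewrite trmx_mul !mulmxA in key; rewrite !mulmxA.
Qed.

(** Multiplied by (g + 1)^T on the left and g + 1 on the right, the defect becomes 2 (g^T eta g -
    eta). *)
Lemma lorentz_icayley g : g + 1%:M \in unitmx -> lorentz g ->
  so_defect (icayley g) = 0.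
Proof.
move=> gU gL; have yE : icayley g *m (g + 1%:M) = g - 1%:M by rewrite mulmxKV.
have gUT : (g + 1%:M)^T \in unitmx by rewrite unitmx_tr.
apply: (can_inj (mulKmx gUT)); apply: (can_inj (mulmxK gU)).
have key : (icayley g *m (g + 1%:M))^T *m eta *m (g + 1%:M) + (g + 1%:M)^T *m
  eta *m (icayley g *m (g + 1%:M)) = 0.
  have tP : (g + 1%:M)^T = g^T + 1%:M by rewrite linearD /= trmx1.
  have tM : (g - 1%:M)^T = g^T - 1%:M by rewrite linearB /= trmx1.
  rewrite yE tP tM.
  rewrite !(mulmxDl, mulmxDr, mulNmx, mulmxN, mul1mx, mulmx1) ?mulmxA gL.
  move: (g^T *m eta) (eta *m g) => A B.
  by apply/matrixP => i j; rewrite !mxE; ring.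
rewrite /= mulmx0 mul0mx -[RHS]key /so_defect [_^T *m
  (_ + eta *m icayley g)]mulmxDr [in LHS]mulmxDl (trmx_mul (icayley g)) !mulmxA.
by [].
Qed.

Definition so_space : {vspace M10} :=
  lker (linfun (HB.pack so_defect (GRing.isLinear.Build _ _ _ _ so_defect
    so_defect_linear) : {linear M10 -> M10})).

Lemma so_spaceE y : (y \in so_space) = (so_defect y == 0).
Proof. by rewrite memv_ker lfunE. Qed.

Lemma Ckmx_cayley k (U : set M10) : open U ->
  (forall y, U y -> \det (1%:M - y) != 0) ->
  Ckmx U k (@cayley R 10).
Proof.
move=> oU U0; apply: CkmxM => //.
  by apply: CkmxD => //; [exact: Ckmx_cst | exact: Ckmx_id].
apply: Ckmx_invmx => //; apply: CkmxD => //; first exact: Ckmx_cst.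
by apply: CkmxN => //; exact: Ckmx_id.
Qed.

Lemma Ckmx_icayley k (V : normedModType R) (U : set V) (F : V -> M10) :
  open U ->
  (forall x, U x -> \det (F x + 1%:M) != 0) ->
  Ckmx U k F -> Ckmx U k (fun x => icayley (F x)).
Proof.
move=> oU U0 Fk; apply: CkmxM => //.
  by apply: CkmxD => //; exact: Ckmx_cst.
by apply: Ckmx_invmx => //; apply: CkmxD => //; exact: Ckmx_cst.
Qed.

Lemma phiprod_embedded : embedded_submanifold (@phiprod R).
Proof.
(* Slice charts: the Cayley transform of [invmx p *m x], on the open set where
   this matrix can only be Lorentz by being in the identity component. *)
exists (\dim so_space) => p pG; have pL := phiprod_lorentz pG;
  have pU := lorentz_unit pL.
pose h (x : M10) : M10 := invmx p *m x.
have hk k (U : set M10) : open U -> Ckmx U k h.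
  by move=> oU; apply: CkmxM => //; [exact: Ckmx_cst | exact: Ckmx_id].
pose U1 : set M10 := [set x | setT x /\ 0 < \det (h x + 1%:M) ^+ 2].
pose U2 : set M10 := [set x | U1 x /\ 0 < h x ord0 ord0].
pose U : set M10 := [set x | U2 x /\ 0 < \det (h x)].
pose U1' : set M10 := [set y | setT y /\ 0 < \det (1%:M - y) ^+ 2].
pose U2' : set M10 := [set y | U1' y /\ 0 < cayley y ord0 ord0].
pose U' : set M10 := [set y | U2' y /\ 0 < \det (cayley y)].
have oT := @openT M10.
have oU1 : open U1.
  apply: open_gt0 => //; apply: (CkM oT); apply: (Ckmx_det oT);
    apply: (CkmxD oT) => //; try exact: hk; exact: Ckmx_cst.
have oU2 : open U2 by apply: open_gt0 => //; exact: hk.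
have oU : open U by apply: open_gt0 => //; apply: Ckmx_det => //; exact: hk.
have oU1' : open U1'.
  apply: open_gt0 => //; apply: (CkM oT); apply: (Ckmx_det oT);
    apply: (CkmxD oT);
  by [exact: Ckmx_cst | apply: CkmxN => //; exact: Ckmx_id].
have sqr0 (a : R) : 0 < a ^+ 2 -> a != 0 by rewrite exprn_even_gt0.
have oU2' : open U2' by apply: open_gt0 => //;
  apply: Ckmx_cayley => // y [_ /sqr0].
have oU' : open U'.
  by apply: open_gt0 => //; apply: Ckmx_det => //;
    apply: Ckmx_cayley => // y [[_ /sqr0]].
have Uunit x : U x -> h x + 1%:M \in unitmx.
  by move=> [[[_ /sqr0 ?] _] _]; rewrite unitmxE unitfE.
have U'unit y : U' y -> 1%:M - y \in unitmx.
  by move=> [[[_ /sqr0 ?] _] _]; rewrite unitmxE unitfE.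
exists U, U', (fun x => icayley (h x)), (fun y => p *m cayley y), so_space;
  split.
- split=> //; rewrite /U /U2 /U1 /= /h mulVmx //.
  rewrite det1 mxE eqxx -mulr2n -scaler_nat detZ det1 mulr1.
  by rewrite exprn_even_gt0 //= expf_neq0 // pnatr_eq0.
- split=> k; apply: Ckmx_Ck => //.
    by apply: Ckmx_icayley => //; [move=> x [[[_ /sqr0]]] | exact: hk].
  apply: CkmxM => //; first exact: Ckmx_cst.
  by apply: Ckmx_cayley => // y [[[_ /sqr0]]].
- move=> x Ux; have [yU yK] := icayleyK (Uunit x Ux); rewrite yK mulKVmx //;
  split=> //.
  rewrite /U' /U2' /U1' /= yK; case: Ux => [[_ h0] hd]; do !split => //.
  by rewrite exprn_even_gt0 //= -unitfE -unitmxE.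
- move=> y Uy; have [gU gK] := cayleyK (U'unit y Uy); rewrite /h mulKmx // gK;
  split=> //.
  rewrite /U /U2 /U1 /= /h mulKmx //; case: Uy => [[_ h0] hd]; do !split => //.
  by rewrite exprn_even_gt0 //= -unitfE -unitmxE.
- move=> x Ux; rewrite so_spaceE; split=> [xG|/eqP so_y].
    apply/eqP/lorentz_icayley; first exact: Uunit.
    by apply: lorentzM (lorentz_V pL) (phiprod_lorentz xG).
  have [yU yK] := icayleyK (Uunit x Ux).
  rewrite -[x](mulKVmx pU); apply: phiprod_mul => //; case: Ux => [[_ h0] hd].
  by apply: phiprod_SO => //; rewrite -/(h x) -yK; apply: so_defect_cayley.
Qed.

Lemma phiprod_Lie : is_Lie_subgroup (@phiprod R).
Proof.
split; [exact: phiprod_GL | exact: phiprod_embedded | exact: smooth_mulmx |].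
(* On Lorentz matrices inversion is the restriction of this linear map, smooth on all of M_10. *)
move=> p pG; exists setT, (fun g => eta *m g^T *m eta); split => //.
- exact: openT.
- move=> k; have oT := @openT M10; apply: (Ckmx_Ck oT); apply: (CkmxM oT);
  last exact: Ckmx_cst.
  apply: (CkmxM oT); first exact: Ckmx_cst.
  by move=> i j; apply: (Ck_ext oT _ (Ckmx_id k oT j i)) => x _; rewrite mxE.
- by move=> x _ xG; rewrite (lorentz_invmx (phiprod_lorentz xG)).
Qed.
End Lie.

(** * The tangent space at the identity *)

Section LieAlg.
Variable R : realType.
Local Notation eta := (@eta R).
Local Notation M10 := 'M[R]_10.
Implicit Types (y g A p : M10).

Lemma so_defectE y i j : so_defect y i j =
  (if j == ord0 then 1 else -1) * y j i + (if i == ord0 then 1 else -1) * y i j.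
Proof. by rewrite mxE mul_mx_diag mul_diag_mx !mxE mulrC. Qed.

(** Each entry of c^T eta c = eta is differentiated at 0, where c is the identity; [h k] is the k-th
    term of the (i, j) entry. *)
Lemma Lie_algebra_sub A : Lie_algebra (@phiprod R) A -> so_defect A = 0.
Proof.
move=> [e [c [e0 _ cG c0 [cd cA]]]].
have dc k l : is_derive (0 : R) (1 : R) (fun t => c t k l : R^o) (A k l).
  apply: DeriveDef; first exact: (derivable_mxP _ _ _).1.
  by rewrite -cA derive_mx // mxE.
apply/matrixP => i j; rewrite so_defectE [RHS]mxE.
pose h k : R -> R^o := (if k == ord0 then 1 else -1) \*:
  ((fun t => c t k i : R^o) * (fun t => c t k j : R^o)).
have dh : is_derive (0 : R) (1 : R) (\sum_(k < 10) h k)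
    (\sum_(k < 10) (if k == ord0 then 1 else -1) *:
      (c 0 k i *: A k j + c 0 k j *: A k i)).
  by apply: is_derive_sum => k; exact:
    (is_deriveZ _ (is_deriveM (dc k i) (dc k j))).
have h0 : 'D_1 (\sum_(k < 10) h k) (0 : R) = 0.
  rewrite (@near_eq_derive _ _ _ _ (cst (eta i j))) ?derive_cst //.
  near=> t; have tG : phiprod (c t).
    apply: cG; near: t; apply: near_in_itvoo.
    by rewrite in_itv /= oppr_lt0 e0.
  have := phiprod_lorentz tG => /matrixP/(_ i j) <-.
  rewrite fct_sumE -mulmxA mxE; apply: eq_bigr => k _.
  rewrite mul_diag_mx !mxE.
  by rewrite -[LHS]/((if k == ord0 then 1 else -1) *
    (c t k i * c t k j)) mulrCA.
have pick (a b : 'I_10) : \sum_(k < 10) (if k == ord0 then 1 else -1) *: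
  (c 0 k a *: A k b) =
    (if a == ord0 then 1 else -1) * A a b.
  rewrite (bigD1 a) //= big1 ?addr0 => [|k ka];
    rewrite c0 mxE ?eqxx ?(negPf ka).
    by rewrite scale1r.
  by rewrite scale0r scaler0.
have := @derive_val _ _ _ _ _ _ _ dh; rewrite h0 => /esym.
rewrite (eq_bigr _ (fun k _ => scalerDr _ _ _)) big_split /= !pick addrC.
by [].
Unshelve. all: by end_near. Qed.

Lemma Lie_algebra_sup A : so_defect A = 0 -> Lie_algebra (@phiprod R) A.
Proof.
(* The Cayley transform has derivative 2 at the origin, hence the half. It stays in the group as
   long as the inequalities of [phiprod_SO] persist, that is, near t = 0. *)
move=> soA; pose B (t : R) : M10 := (t / 2) *: A;
  pose c t : M10 := cayley (B t).
have oT := @openT R^o.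
have Bk k (U : set R^o) : open U -> Ckmx U k B.
  move=> oU i j; apply: (Ck_ext oU (f := fun t => t * (2^-1 * A i j))).
    by move=> t _; rewrite mxE mulrA.
  apply: CkM => //; last exact: (Ck_cst oU k (_ : R^o)).
  by apply: Ck_lin => //; move=> x; exact: cvg_id.
have Dk k (U : set R^o) : open U -> Ckmx U k (fun t => 1%:M - B t).
  by move=> oU; apply: CkmxD => //;
    [exact: Ckmx_cst | apply: CkmxN => //; exact: Bk].
pose U1 : set R^o := [set t | setT t /\ 0 < \det (1%:M - B t) ^+ 2].
have sqr0 (a : R) : 0 < a ^+ 2 -> a != 0 by rewrite exprn_even_gt0.
have U1unit t : U1 t -> 1%:M - B t \in unitmx by move=> [_ /sqr0 ?];
  rewrite unitmxE unitfE.
have ck k (U : set R^o) : open U -> U `<=` U1 -> Ckmx U k c.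
  move=> oU UU1; apply: CkmxM => //.
    by apply: CkmxD => //; [exact: Ckmx_cst | exact: Bk].
  by apply: Ckmx_invmx => //; [move=> t /UU1[_ /sqr0] | exact: Dk].
pose U2 : set R^o := [set t | U1 t /\ 0 < c t ord0 ord0].
pose U3 : set R^o := [set t | U2 t /\ 0 < \det (c t)].
have oU1 : open U1 by apply: open_gt0 => //; apply: CkM => //;
  apply: Ckmx_det => //; exact: Dk.
have oU2 : open U2 by apply: open_gt0 => //; exact: ck.
have oU3 : open U3.
  by apply: open_gt0 => //; apply: Ckmx_det => //; apply: ck => // t [].
have B0 : B 0 = 0 by rewrite /B mul0r scale0r.
have c0 : c 0 = 1%:M by rewrite /c B0 /cayley addr0 subr0 mul1mx invmx1.
have U30 : U3 0.
  by rewrite /U3 /U2 /U1 /= B0 subr0 c0 !det1 mxE eqxx expr1n; do !split;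
    rewrite ?ltr01.
have c_phiprod t : U3 t -> phiprod (c t).
  move=> [[U1t ct0] dct]; apply: phiprod_SO => //; apply: so_defect_cayley;
    first exact: U1unit.
  by rewrite (linfZ (@so_defect_linear R)) soA scaler0.
have /nbhs_ballP[e /= e0 eU3] : nbhs (0 : R^o) U3 by apply: open_nbhs_nbhs.
have eU t : t \in `]- e, e[ -> U3 t.
  rewrite in_itv /= => te; apply: eU3;
    rewrite /ball /= sub0r normrN ltr_norml //.
exists e, c; split => //.
- move=> k; apply: Ckmx_Ck; first exact: itv_open.
  by apply: ck; [exact: itv_open | move=> t /eU[[]]].
- by move=> t /eU/c_phiprod.
(* For t nonzero in [U1] this is the difference quotient (c t - 1) / t, and it is continuous at 0
   with value A. *)
pose Psi t : M10 := A *m invmx (1%:M - B t).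
have Psik : Ck_on (W := 'M[R]_10) 0 U1 Psi.
  apply: Ckmx_Ck => //; apply: CkmxM => //; first exact: Ckmx_cst.
  by apply: Ckmx_invmx => //; [move=> t [_ /sqr0] | exact: Dk].
have Psi0 : Psi t @[t --> (0:R^o)] --> A.
  have := Psik 0; rewrite (_ : A = Psi 0); first by apply; case: U30 => [[]].
  by rewrite /Psi B0 subr0 invmx1 mulmx1.
have cA : (h^-1 *: ((c \o shift (0 : R)) (h *: (1 : R)) - c 0))
  @[h --> (0 : R)^'] --> A.
  have : Psi t @[t --> (0 : R)^'] --> A by apply: cvg_trans Psi0;
    apply: cvg_app; exact: cvg_within.
  apply: cvg_trans; apply: near_eq_cvg; near=> h.
  have hU : U1 h.
    near: h; apply: nbhs_dnbhs; apply: filterS (open_nbhs_nbhs (conj oU3 U30)).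
    by move=> t [[]].
  have h0 : h != 0 by near: h; exact: nbhs_dnbhs_neq.
  rewrite /= addr0 [h *: 1]mulr1 c0 /c /cayley -[X in _ -
    X](mulmxV (U1unit h hU)) -mulmxBl.
  rewrite opprB [1%:M + _]addrC addrACA subrr addr0 -scalerDl -splitr.
  by rewrite -scalemxAl scalerA mulVf // scale1r.
split; first by apply/cvg_ex; exists A.
exact: cvg_lim cA.
Unshelve. all: by end_near. Qed.
End LieAlg.

(** * The algebra sl(2, O) *)

Section SL2OMatrix.
Variable R : realType.
Local Notation eta := (@eta R).
Implicit Types (a r t : R) (X : M2O R) (u v : sl2O_space R).

Lemma so_mink (A : 'M[R]_10) : so_defect A = 0 <-> forall v : 'cV[R]_10,
  mink v (A *m v) = 0.
Proof.
have E (v : 'cV[R]_10) : (v^T *m (so_defect A *m v)) 0 0 = 2 * mink v (A *m v).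
  rewrite /so_defect mulmxDl mulmxDr mxE -[_ *m eta *m v]mulmxA -[eta *m A *m
    v]mulmxA.
  rewrite -/(mink v _) (mulmxA v^T) -trmx_mul -/(mink (A *m v) v) minkC; ring.
split=> [A0 v|A0].
  by have := E v; rewrite A0 mul0mx mulmx0 mxE => /esym/eqP;
    rewrite mulf_eq0 pnatr_eq0 => /eqP.
apply: quad_eq0 => [|v]; last by rewrite E A0 mulr0.
by rewrite /so_defect linearD /= !trmx_mul trmxK tr_eta addrC.
Qed.

Lemma odotDr (x y z : oct R) : odot x (y + z) = odot x y + odot x z.
Proof. by rewrite !odotE -big_split; apply: eq_bigr => k _;
  rewrite mxE mulrDr. Qed.

Lemma odotZr a (x y : oct R) : odot x (a *: y) = a * odot x y.
Proof. by rewrite !odotE mulr_sumr; apply: eq_bigr => k _;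
  rewrite mxE mulrCA. Qed.

Lemma orealE a : oreal a = a *: oreal 1 :> oct R.
Proof. by oct_ring. Qed.

(** For linear T: infinitesimal rotations of Im(O), extended by 0 on the reals; commutators and
    derivations are both of this kind. *)
Definition im_rot (T : oct R -> oct R) :=
  [/\ T (oreal 1) = 0, forall x, oRe (T x) = 0 & forall x, odot x (T x) = 0].

Lemma C_ImO_rot (C : 'End(oct R)) : C_ImO C -> im_rot C.
Proof.
move=> [d dIm CE]; split=> [|x|x]; rewrite CE.
- by rewrite omul_real_l omul_real_r subrr.
- by case: (octP x) => *; case: (octP d) => *; rewrite !octE; ring.
- by rewrite odotDr odotNr odot_mull odot_mulr dIm subrr.
Qed.

(** The square of an imaginary x is real, hence killed by D, so x D(x) + D(x) x = 0. Its imaginary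
    part is 2 Re(D x) x and its real part is -2 times the inner product of x and D x. *)
Lemma Der_O_rot (D : 'End(oct R)) : Der_O D -> im_rot D.
Proof.
move=> DM; have D1 : D (oreal 1) = 0.
  have := DM (oreal 1) (oreal 1); rewrite !(omul_real_l,
    omul_real_r) !scale1r => h.
  by apply: (addrI (D (oreal 1))); rewrite addr0 -h.
have sqr_im (x : oct R) : oRe x = 0 -> omul x x = oreal (- onormsq x).
  rewrite /onormsq; case: (octP x) => x0 x1 x2 x3 x4 x5 x6 x7;
    rewrite !octE => ->.
  by apply: mkoct_eq; split; ring.
have im (x : oct R) : oRe x = 0 -> oRe (D x) = 0 /\ odot x (D x) = 0.
  move=> x0; have := DM x x; rewrite sqr_im // orealE linearZ /= D1 scaler0.
  have [->|] := eqVneq x 0; first by rewrite linear0 /odot !octE; split => //;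
    ring.
  rewrite /odot; move: x0; case: (octP x) => {x} x0 x1 x2 x3 x4 x5 x6 x7.
  case: (octP (D _)) => y0 y1 y2 y3 y4 y5 y6 y7; rewrite !octE => ->.
  move=> xn0 /mkoct_inj[[h0 h1 h2 h3] [h4 h5 h6 h7]].
  have [y00|y00] := eqVneq y0 0; first by rewrite y00 in h0 *; split => //; lra.
  case/eqP: xn0; apply: mkoct_eq; split => //; apply: (mulfI y00);
    rewrite mulr0; lra.
have split_re (x : oct R) : x = oreal (oRe x) +
  (x - oreal (oRe x)) by rewrite addrC subrK.
have im_part (x : oct R) : oRe (x - oreal (oRe x)) = 0.
  by case: (octP x) => *; rewrite !octE; ring.
have DE (x : oct R) : D x = D (x - oreal (oRe x)).
  by rewrite linearB /= orealE linearZ /= D1 scaler0 subr0.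
split=> [//|x|x]; first by rewrite DE; have [] := im _ (im_part x).
have [h1 h2] := im _ (im_part x).
rewrite DE; move: h1 h2; set y := D _; rewrite /odot.
case: (octP y) => y0 y1 y2 y3 y4 y5 y6 y7;
  case: (octP x) => x0 x1 x2 x3 x4 x5 x6 x7; rewrite !octE => h1 h2.
by rewrite h1 in h2 *; lra.
Qed.

Lemma im_rot_real (T : 'End(oct R)) a : im_rot T -> T (oreal a) = 0.
Proof. by move=> [T1 _ _]; rewrite orealE linearZ /= T1 scaler0. Qed.

Lemma im_rot_conj (T : 'End(oct R)) x : im_rot T ->
  T (oconj x) = - T x /\ oconj (T x) = - T x.
Proof.
move=> rT; have [_ Tre _] := rT; split; last first.
  move: (Tre x); case: (octP (T x)) => y0 y1 y2 y3 y4 y5 y6 y7;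
    rewrite !octE => ->.
  by apply: mkoct_eq; split; ring.
have -> : oconj x = oreal (2 * oRe x) - x.
  by case: (octP x) => *; oct_ring.
by rewrite linearB /= im_rot_real // sub0r.
Qed.

Definition sl2O_rot u (x : oct R) : oct R := u.1.2 x + u.2 x.

(** In the splitting R + O + R, Re(a) acts as a boost on the diagonal, b and c mix the diagonal with
    O, and Im(a) joins [sl2O_rot] in acting on O. *)
Lemma sl2O_act_herm u r (x : oct R) t : sl2O u ->
  let a := u.1.1 0 0 in let b := u.1.1 0 1 in let c := u.1.1 1 0 in
  sl2O_act u (herm r x t) =
  herm (2 * (r * oRe a + odot b x))
       (omul a x - omul x (oconj a) + t *: b + r *: oconj c + sl2O_rot u x)
       (2 * (odot (oconj c) x - t * oRe a)).
Proof.
case: u => [[N C] D] [/= Ntr /C_ImO_rot rC /Der_O_rot rD] /=.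
have N11 : N 1 1 = - N 0 0.
  by apply/eqP; rewrite -addr_eq0 addrC; apply/eqP.
have [Cx Ccx] := im_rot_conj x rC; have [Dx Dcx] := im_rot_conj x rD.
have DE A B i j : (A + B : M2O R) i j = A i j + B i j by rewrite mxE.
have h00 s y w : herm s y w 0 0 = oreal s :> oct R by rewrite mxE.
have h01 s y w : herm s y w 0 1 = y :> oct R by rewrite mxE.
have h10 s y w : herm s y w 1 0 = oconj y :> oct R by rewrite mxE.
have h11 s y w : herm s y w 1 1 = oreal w :> oct R by rewrite mxE.
have mapE (f : oct R -> oct R) A i j : map_mx f A i j =
  f (A i j) :> oct R by rewrite mxE.
have dagE A i j : odag A i j = oconj (A j i) :> oct R by rewrite mxE.
rewrite /sl2O_act /sl2O_rot /=.
apply: M2O_eqP; rewrite !DE !omulmxE !mapE !dagE !(h00, h01, h10, h11) ?N11.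
- rewrite !im_rot_real // !addr0 /odot !(omul_real_l, omul_real_r).
  case: (octP x) => *; case: (octP (N 0 0)) => *; case: (octP (N 0 1)) => *;
    oct_ring.
- rewrite [RHS]addrA; congr (_ + _ + _); rewrite !(omul_real_l, omul_real_r).
  case: (octP x) => *; case: (octP (N 0 0)) => *; case: (octP (N 0 1)) => *;
    case: (octP (N 1 0)) => *; oct_ring.
- rewrite Cx Dx -Ccx -Dcx (oconjD _ (C x + D x)) (oconjD (C x)) [RHS]addrA;
  congr (_ + _ + _); rewrite !(omul_real_l, omul_real_r).
  case: (octP x) => *; case: (octP (N 0 0)) => *; case: (octP (N 0 1)) => *;
    case: (octP (N 1 0)) => *; oct_ring.
- rewrite !im_rot_real // !addr0 /odot !(omul_real_l, omul_real_r).
  case: (octP x) => *; case: (octP (N 0 0)) => *; case: (octP (N 1 0)) => *;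
    oct_ring.
Qed.

Lemma sl2O_act_linear u : linear (sl2O_act u).
Proof.
have map_lin (T : 'End(oct R)) : linear (fun X : M2O R => map_mx T X : M2O R).
  by move=> a X Y; apply/matrixP => i j; rewrite M2O_linE !mxE linearP.
exact: (linear_addf (linear_addf (linear_addf (omulmx_linearr u.1.1)
  (omulmx_linearl (odag u.1.1))) (map_lin u.1.2)) (map_lin u.2)).
Qed.

Lemma sl2O_act_linearl X : linear (fun u => sl2O_act u X).
Proof.
move=> a [[N C] D] [[N' C'] D'].
have map_lin (T T' : 'End(oct R)) : map_mx (a *: T + T') X = a *:
  (map_mx T X : M2O R) + map_mx T' X :> M2O R.
  by apply/matrixP => i j; rewrite M2O_linE !mxE add_lfunE scale_lfunE.
rewrite /sl2O_act /= odag_linear omulmx_linearl omulmx_linearr !map_lin.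
rewrite !scalerDr.
have add4 (p q p' q' s s' m m' : M2O R) :
    p + q + (p' + q') + (s + s') + (m + m') = p + p' + s + m +
      (q + q' + s' + m').
  by rewrite (addrACA p) (addrACA (p + p')) (addrACA (p + p' + s)).
exact: add4.
Qed.

Lemma sl2O_matrix_linear : linear (@sl2O_matrix R).
Proof.
move=> a u v; apply/matrixP => i j.
have E w : sl2O_matrix w i j = cV_of_h2 (sl2O_act w (h2_of_cV (delta_mx j 0)))
  i 0.
  by rewrite mxE.
rewrite E sl2O_act_linearl cV_of_h2_linear mxE [X in X +
  _]mxE [RHS]mxE [X in _ = X + _]mxE.
by rewrite -!E.
Qed.

Lemma sl2O_act_h2 u X : sl2O u -> h2 X -> h2 (sl2O_act u X).
Proof. by move=> uS /h2_herm ->; rewrite sl2O_act_herm //; apply: herm_h2. Qed.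

Lemma sl2O_matrixE u (v : 'cV[R]_10) : sl2O u ->
  sl2O_act u (h2_of_cV v) = h2_of_cV (sl2O_matrix u *m v).
Proof.
move=> uS; apply: h2_matrixE; first exact: sl2O_act_linear.
by move=> X; apply: sl2O_act_h2.
Qed.

Lemma herm_inj (r t r' t' : R) (x x' : oct R) : herm r x t = herm r' x' t' ->
  [/\ r = r', x = x' & t = t'].
Proof.
move=> /matrixP E; have := (E 0 0, E 0 1, E 1 1).
rewrite !mxE /= !oreal_mk => -[[/mkoct_inj[[? _ _ _] _] ?]
  /mkoct_inj[[? _ _ _] _]].
by split.
Qed.

Lemma sl2O_matrix_coord u (v : 'cV[R]_10) : sl2O u ->
  [/\ (sl2O_matrix u *m v) ord0 0 + (sl2O_matrix u *m v) ord_max 0 =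
        2 * ((v ord0 0 + v ord_max 0) * oRe (u.1.1 0 0) +
          odot (u.1.1 0 1) (xpart v)),
      xpart (sl2O_matrix u *m v) =
        omul (u.1.1 0 0) (xpart v) - omul (xpart v) (oconj (u.1.1 0 0)) +
        (v ord0 0 - v ord_max 0) *: u.1.1 0 1 +
        (v ord0 0 + v ord_max 0) *: oconj (u.1.1 1 0) + sl2O_rot u (xpart v)
    & (sl2O_matrix u *m v) ord0 0 - (sl2O_matrix u *m v) ord_max 0 =
        2 * (odot (oconj (u.1.1 1 0)) (xpart v) - (v ord0 0 - v ord_max 0) *
          oRe (u.1.1 0 0))].
Proof.
move=> uS; apply: herm_inj; rewrite -h2_of_cVE -sl2O_matrixE //.
by rewrite h2_of_cVE sl2O_act_herm.
Qed.

Lemma odotC (x y : oct R) : odot x y = odot y x.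
Proof. by rewrite !odotE; apply: eq_bigr => k _; rewrite mulrC. Qed.

Lemma sl2O_rot_skew u (x : oct R) : sl2O u -> odot x (sl2O_rot u x) = 0.
Proof.
by move=> [_ /C_ImO_rot[_ _ C0] /Der_O_rot[_ _ D0]]; rewrite odotDr C0 D0 addr0.
Qed.

Lemma odot_ad (a x : oct R) : odot x (omul a x - omul x (oconj a)) = 0.
Proof.
by rewrite odotDr odotNr odot_mull odot_mulr; case: (octP a) => *;
  rewrite !octE subrr.
Qed.

Lemma sl2O_matrix_so u : sl2O u -> so_defect (sl2O_matrix u) = 0.
Proof.
move=> uS; apply/so_mink => v; have [hr hx ht] := sl2O_matrix_coord v uS.
rewrite minkE hx (odotDr _ _ (sl2O_rot _ _)) sl2O_rot_skew // addr0.
rewrite (odotDr _ _ (_ *: oconj _)) (odotDr _ _ (_ *: u.1.1 0 1)) odot_ad add0r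
  !odotZr.
move: hr ht; rewrite [odot _ (xpart v)]odotC [odot (oconj _) (xpart v)]odotC.
set w := sl2O_matrix u *m v => hr ht.
set p := odot (xpart v) _ in hr *; set q := odot (xpart v) _ in ht *.
set w0 := w ord0 0 in hr ht *; set w9 := w ord_max 0 in hr ht *.
set al := oRe _ in hr ht.
have e0 : w0 = ((v ord0 0 + v ord_max 0) * al + p) +
  (q - (v ord0 0 - v ord_max 0) * al) by lra.
have e9 : w9 = ((v ord0 0 + v ord_max 0) * al + p) -
  (q - (v ord0 0 - v ord_max 0) * al) by lra.
rewrite e0 e9.
ring.
Qed.

End SL2OMatrix.

(** * The bijection between sl(2, O) and so(9,1) *)

Section SL2OBijection.
Variable R : realType.
Local Notation eta := (@eta R).
Implicit Types (u v : sl2O_space R).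

(** The two diagonal idempotents detect Re(a), b and c; at x = 1 the rotations vanish and Im(a) is
    left. Then the commutator with d - d' is a difference of derivations, so [commutator_der_eq0]
    applies. *)
Lemma sl2O_matrix_inj u v : sl2O u -> sl2O v -> sl2O_matrix u =
  sl2O_matrix v -> u = v.
Proof.
move=> uS vS uv.
have actE (r t : R) (x : oct R) : sl2O_act u (herm r x t) =
  sl2O_act v (herm r x t).
  pose w := cV_of_h2 (herm r x t).
  have <- : h2_of_cV w = herm r x t := cV_of_h2K (herm_h2 r x t).
  by rewrite (sl2O_matrixE w uS) (sl2O_matrixE w vS) uv.
case: u v uS vS {uv} actE => [[N C] D] [[N' C'] D'] uS vS actE.
have rot0 w : sl2O w -> sl2O_rot w 0 = 0 by move=> _;
  rewrite /sl2O_rot !linear0 addr0.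
have E r t x := actE r t x.
have := actE 1 0 0; rewrite !sl2O_act_herm //= => /herm_inj[].

have odot0 (y : oct R) : odot y 0 = 0 by rewrite -[0](scale0r y) odotZr mul0r.
have omul0 (y : oct R) : omul 0 y = 0 /\ omul y 0 = 0.
  by rewrite -[0](scale0r y) omulZl omulZr !scale0r.
have l0 y := (omul0 y).1; have r0 y := (omul0 y).2.
rewrite !odot0 !l0 !r0 !rot0 // !scale0r !scale1r !subrr !mul0r !addr0 !add0r
  !mul1r => hre hc _.
have := actE 0 1 0; rewrite !sl2O_act_herm //= => /herm_inj[_].
rewrite !l0 !r0 !rot0 // !scale0r !scale1r !subrr !addr0 !add0r => hb _.
have hx x : omul (N 0 0) x - omul x (oconj (N 0 0)) + sl2O_rot (N, C, D) x =
            omul (N' 0 0) x - omul x (oconj (N' 0 0)) + sl2O_rot (N', C', D') x.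
  have := actE 0 0 x; rewrite !sl2O_act_herm //= => /herm_inj[_].
  by rewrite !scale0r !addr0.
have [Ntr CC DD] := uS; have [Ntr' CC' DD'] := vS.
rewrite /= in Ntr CC DD Ntr' CC' DD'.
have [C1 _ _] := C_ImO_rot CC; have [D1 _ _] := Der_O_rot DD.
have [C1' _ _] := C_ImO_rot CC'; have [D1' _ _] := Der_O_rot DD'.
have ha : N 0 0 = N' 0 0.
  have := hx (oreal 1); rewrite /sl2O_rot /= C1 D1 C1' D1' !(omul_real_l,
    omul_real_r) !addr0 !scale1r.
  move: hre; case: (octP (N 0 0)) => a0 a1 a2 a3 a4 a5 a6 a7;
    case: (octP (N' 0 0)) => b0 b1 b2 b3 b4 b5 b6 b7.
  rewrite !octE => h0 /mkoct_inj[[_ h1 h2 h3] [h4 h5 h6 h7]].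
  by apply: mkoct_eq; split; lra.
have NN : N = N'.
  apply: M2O_eqP => //; first exact: (can_inj (@oconjK R)).
  by move/eqP: Ntr; move/eqP: Ntr';
    rewrite /traceless /= ha !(addrC (N' 0 0)) !addr_eq0 => /eqP -> /eqP ->.
have [d dIm CE] := CC; have [d' dIm' CE'] := CC'.
have CDx x : C x - C' x = D' x - D x.
  have := hx x; rewrite ha => /addrI; rewrite /sl2O_rot /= => h.
  by rewrite -[C x](addrK (D x)) h addrAC (addrC (C' x)) addrK.
have oNl (x y : oct R) : omul (- x) y = -
  omul x y by rewrite -scaleN1r omulZl scaleN1r.
have oNr (x y : oct R) : omul y (- x) = -
  omul y x by rewrite -scaleN1r omulZr scaleN1r.
have Fe z : omul (d - d') z - omul z (d - d') = D' z - D z.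
  by rewrite -CDx CE CE' omulDl omulDr oNl oNr !opprD !opprK addrACA.
have e0 : d - d' = 0.
  apply: commutator_der_eq0.
    by move: dIm dIm'; rewrite /oRe !mxE => -> ->; rewrite subrr.
  move=> x y /=; rewrite !Fe DD DD' !(omulDl, omulDr) oNl oNr opprD.
  by rewrite addrACA.
have CC0 : C = C'.
  by apply/lfunP => x; rewrite CE CE'; move/eqP: e0;
    rewrite subr_eq0 => /eqP ->.
have DD0 : D = D'.
  by apply/lfunP => x; have /eqP := CDx x; rewrite CC0 subrr eq_sym subr_eq0 =>
    /eqP.
by rewrite NN CC0 DD0.
Qed.

Lemma commutator_linear (d : oct R) : linear (fun x => omul d x - omul x d).
Proof.
move=> a x y; rewrite omulDr omulDl omulZr omulZl scalerBr opprD.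
by rewrite addrACA.
Qed.

Lemma sl2O_matrix_surj (A : 'M[R]_10) : so_defect A = 0 ->
  exists2 u : sl2O_space R, sl2O u & sl2O_matrix u = A.
Proof.
move=> soA.
have skew i j : (if j == ord0 then 1 else -1) * A j i +
  (if i == ord0 then 1 else -1) * A i j = 0.
  by rewrite -so_defectE soA mxE.
pose col0 := xpart (col ord0 A); pose col9 := xpart (col ord_max A).
(* The action sends the axes 0 and 9 to elements with octonion parts b + conj(c) and conj(c) - b;
   these equations are solved here. *)
pose b : oct R := 2^-1 *: (col0 - col9);
  pose c := oconj (2^-1 *: (col0 + col9)).
(* Transposed, because octonions are rows and are acted on from the right. *)
pose B : 'M[R]_8 := \matrix_(i, j) A (inord j.+1) (inord i.+1).
have BT : B^T = - B.
  apply/matrixP => i j; rewrite !mxE.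
  by have := skew (inord i.+1) (inord j.+1); have [-> _ _] := inord_mid i;
    have [-> _ _] := inord_mid j; lra.
(* The map x -> p x + x p takes 1 to 2 p, so subtracting it from B leaves an element Q of so(7). *)
pose p := 2^-1 *: (oreal 1 *m B).
have pIm : oRe p = 0.
  rewrite /p /oreal scale1r -rowE; have /matrixP/(_ 0 0) := BT;
    rewrite /oRe !mxE => h; lra.
(* The (0, 9) entry of the action is 2 Re(a). *)
pose a := oreal (A ord0 ord_max / 2) + p.
have ad_lin : linear (fun x => omul p x + omul x p).
  by move=> k x y; rewrite omulDr omulDl omulZr omulZl scalerDr addrACA.
pose adp : {linear oct R -> oct R} :=
  HB.pack (fun x : oct R => omul p x +
    omul x p) (GRing.isLinear.Build _ _ _ _ _ ad_lin).
pose Q := B - lin1_mx adp.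
have QE x : x *m Q = x *m B - (omul p x +
  omul x p) by rewrite mulmxBr mul_rV_lin1.
have odot_mx (x : oct R) (M : 'M[R]_8) : odot x (x *m M) = (x *m M *m x^T) 0 0.
  by rewrite odotE mxE; apply: eq_bigr => k _; rewrite [x^T _ _]mxE mulrC.
have tr1 (M : 'M[R]_1) : M^T 0 0 = M 0 0 by rewrite mxE.
have xB0 x : odot x (x *m B) = 0.
  have : odot x (x *m B) = - odot x (x *m B).
    by rewrite {1}odot_mx -tr1 !trmx_mul trmxK BT mulNmx mulmxN mxE odot_mx
      mulmxA.
  by move=> h; lra.
have xQ0 x : odot x (x *m Q) = 0.
  by rewrite QE odotDr odotNr xB0 odotDr odot_mull odot_mulr pIm !mul0r addr0
    subr0.
have QT : Q^T = - Q.
  apply/eqP; rewrite -addr_eq0; apply/eqP/quad_eq0 => [|v].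
    by rewrite linearD /= trmxK addrC.
  have h1 : (v^T *m (Q *m v)) 0 0 = 0 by rewrite mulmxA -{2}[v]trmxK -odot_mx.
  rewrite mulmxDl mulmxDr mxE h1 addr0.
  by rewrite -tr1 !trmx_mul !trmxK -mulmxA.
have Q1 : oreal 1 *m Q = 0.
  by rewrite QE omul_real_l omul_real_r !scale1r /p -scalerDl (_ : _ + _ =
    1 :> R) ?scale1r ?subrr //; field.
have Q0 i : ent Q 0 i = 0.
  rewrite /ent (_ : inord 0 = 0); last by apply: val_inj; rewrite /= inordK.
  by move/rowP: Q1 => /(_ (inord i)); rewrite /oreal scale1r -rowE !mxE.
have [d dIm [G Gg2 QG]] := so7_split QT Q0.
pose N : M2O R := \matrix_(i, j) if i == 0 then (if j == 0 then a else b) else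
  (if j == 0 then c else - a).
have com_lin := commutator_linear d.
pose Cf : {linear oct R -> oct R} :=
  HB.pack (fun x : oct R => omul d x -
    omul x d) (GRing.isLinear.Build _ _ _ _ _ com_lin).
pose u : sl2O_space R := (N, linfun Cf, linfun (mulmxr G)).
have N00 : u.1.1 0 0 = a by rewrite mxE.
have N01 : u.1.1 0 1 = b by rewrite mxE.
have N10 : u.1.1 1 0 = c by rewrite mxE.
have N11 : u.1.1 1 1 = - a by rewrite mxE.
have CE x : u.1.2 x = omul d x - omul x d by rewrite -[u.1.2]/(linfun Cf) lfunE.
have DE x : u.2 x = x *m G by rewrite -[u.2]/(linfun (mulmxr G)) lfunE.
have uS : sl2O u.
  split.
  - by rewrite -[traceless _]/(u.1.1 0 0 + u.1.1 1 1 = 0) N00 N11 subrr.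
  - by exists d.
  - by move=> x y; rewrite !DE; apply: g2_matrix_der.
clearbody u.
exists u => //.
pose A' := sl2O_matrix u; have soA' : so_defect A' = 0 := sl2O_matrix_so uS.
have skew' i j : (if j == ord0 then 1 else -1) * A' j i +
  (if i == ord0 then 1 else -1) * A' i j = 0.
  by rewrite -so_defectE soA' mxE.
have aRe : oRe a = A ord0 ord_max / 2.
  rewrite /a; move: pIm; case: (octP p) => p0 p1 p2 p3 p4 p5 p6 p7.
  by rewrite !octE => ->; rewrite addr0.
have aE x : omul a x - omul x (oconj a) = omul p x + omul x p.
  rewrite /a; move: pIm; case: (octP p) => p0 p1 p2 p3 p4 p5 p6 p7.
  case: (octP x) => x0 x1 x2 x3 x4 x5 x6 x7; rewrite !octE => ->.
  by apply: mkoct_eq; split; ring.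
have bcE (k l : R) : (k - l) *: b + (k + l) *: oconj c = k *: col0 + l *: col9.
  by rewrite /b /c oconjK; apply/rowP => i; rewrite !mxE; field.
have AE (v : 'cV[R]_10) : xpart (A *m v) = v ord0 0 *: col0 + v ord_max 0 *:
  col9 + xpart v *m B.
  apply/rowP => k; rewrite !mxE sum_ord10 addrAC (mulrC (v ord0 0))
    (mulrC (v ord_max 0)).
  by congr (_ + _ + _); apply: eq_bigr => l _; rewrite !mxE mulrC.
have mid (v : 'cV[R]_10) : xpart (A' *m v) = xpart (A *m v).
  have [_ -> _] := sl2O_matrix_coord v uS.
  have rotE x : sl2O_rot u x = x *m B - (omul p x + omul x p).
    by rewrite -QE QG /sl2O_rot CE DE.
  rewrite N00 N01 N10 rotE aE AE.
  by rewrite -(addrA (_ + omul _ p)) bcE (addrC (_ + omul _ p)) addrACA subrr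
    addr0.
have entry (M : 'M[R]_10) i j : M i j = (M *m delta_mx j (0 : 'I_1)) i 0.
  by rewrite -colE mxE.
(* Once the eight middle rows agree, skewness of both matrices settles the middle columns and the
   diagonal; only the entries (0, 9) and (9, 0) remain. *)
have rowsE (k : 'I_8) j : A' (inord k.+1) j = A (inord k.+1) j.
  by rewrite !entry; have /rowP/(_ k) := mid (delta_mx j 0);
    rewrite [xpart _ _ _]mxE [in X in _ = X -> _]mxE.
have colsE (k : 'I_8) j : A' j (inord k.+1) = A j (inord k.+1).
  have := skew (inord k.+1) j; have := skew' (inord k.+1) j; rewrite rowsE.
  have [-> _ _] := inord_mid k; case: ifP => _; lra.
have diag (M : 'M[R]_10) i : so_defect M = 0 -> M i i = 0.
  by move=> /matrixP/(_ i i); rewrite so_defectE mxE; case: ifP => _; lra.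
have E09 : A' ord0 ord_max = A ord0 ord_max.
  have x0 : xpart (delta_mx ord_max 0 : 'cV[R]_10) = 0.
    by apply/rowP => k; rewrite !mxE; have [_ -> _] := inord_mid k.
  have od0 (y : oct R) : odot y 0 = 0 by rewrite -[0](scale0r y) odotZr mul0r.
  have [] := sl2O_matrix_coord (delta_mx ord_max 0) uS.
  rewrite -!entry x0 !od0 N00 aRe [delta_mx _ _ ord0 _]mxE
    [delta_mx _ _ ord_max _]mxE !eqxx /= -/A'.
  by move=> h1 _ h2; lra.
have E90 : A' ord_max ord0 = A ord_max ord0.
  have := skew ord0 ord_max; have := skew' ord0 ord_max; rewrite !eqxx /= E09;
    lra.
apply/matrixP => i j.
case: (ord10P i) => [->|->|[k ->]]; last exact: rowsE.
  case: (ord10P j) => [->|->|[k ->]];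
    [by rewrite !diag | exact: E09 | exact: colsE].
by case: (ord10P j) => [->|->|[k ->]];
  [exact: E90 | by rewrite !diag | exact: colsE].
Qed.
End SL2OBijection.

(** With surjectivity of varphi, this provides the element that [xget] selects in [sl2O_bracket]. *)
Lemma so_defect_bracket (R : realType) (A B : 'M[R]_10) :
  so_defect A = 0 -> so_defect B = 0 -> so_defect (mx_bracket A B) = 0.
Proof.
move=> /eqP; rewrite addr_eq0 => /eqP hA /eqP; rewrite addr_eq0 => /eqP hB.
have tB : (A *m B - B *m A)^T = B^T *m A^T - A^T *m
  B^T by rewrite linearB /= !trmx_mul.
rewrite /so_defect /mx_bracket tB mulmxBl mulmxBr -!mulmxA hA hB.
rewrite !mulmxN !mulmxA hA hB !mulNmx !opprK.
by rewrite addrC addrA subrK subrr.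
Qed.

Lemma Lie_algebra_so (R : realType) : Lie_algebra (@SL2O R) =
  [set A | so_defect A = 0].
Proof.
rewrite SL2O_phiprod; apply/seteqP; split => A /=;
  [exact: Lie_algebra_sub | exact: Lie_algebra_sup].
Qed.

Theorem theorem1 (R : realType) :
  [/\ (* the generated group, with composition as operation ... *)
      is_GL_subgroup (@SL2O R),
      (* ... consists of all the finite compositions of generators *)
      (forall g : 'M[R]_10, SL2O g <->
         exists2 s : seq (M2O R), (forall M, M \in s -> admissible M) &
           g = h2_matrix (foldr (fun M F => phi M \o F) idfun s)),
      (* it is a Lie group ... *)
      is_Lie_subgroup (@SL2O R)
    & (* ... whose Lie algebra is sl(2, O) *)
      [/\ (forall (a : R) (u v : sl2O_space R),
             sl2O_matrix (a *: u + v) = a *: sl2O_matrix u + sl2O_matrix v),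
          set_bij (@sl2O R) (Lie_algebra (@SL2O R)) (@sl2O_matrix R)
        & forall u v : sl2O_space R, sl2O u -> sl2O v ->
            sl2O (sl2O_bracket u v) /\
            sl2O_matrix (sl2O_bracket u v) =
              mx_bracket (sl2O_matrix u) (sl2O_matrix v)]].
Proof.
split.
- by rewrite SL2O_phiprod; exact: phiprod_GL.
- by move=> g; rewrite SL2O_phiprod.
- by rewrite SL2O_phiprod; exact: phiprod_Lie.
rewrite Lie_algebra_so; split.
- exact: sl2O_matrix_linear.
- split.
  + by move=> u uS; exact: sl2O_matrix_so.
  + by move=> u v; rewrite !inE => uS vS; exact: sl2O_matrix_inj.
  + by move=> A /sl2O_matrix_surj[u uS <-]; exists u.
move=> u v uS vS.
have [w wS wE] :=
  sl2O_matrix_surj (so_defect_bracket (sl2O_matrix_so uS) (sl2O_matrix_so vS)).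
by apply: (@xgetPex _ 0 [set w | sl2O w /\ sl2O_matrix w = _]); exists w.
Qed.
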